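(* Let $\Omega=(0,1)^2$ and let $f\in C^1(\overline{\Omega}\times[0,1])$. Let $\varepsilon>0$, $0<\varepsilon_\nu\ll 1$, $\lambda>0$, $\alpha^{(1)}>0$ and $\alpha^{(2)}>0$ be fixed constants. Then the functional \[ \mathcal{F}_s(\vec u^{(1)},\vec u^{(2)}) := \int_0^1 \big\|\vec u^{(1)}(\cdot,t)+\vec u^{(2)}(\cdot,t)-\vec\phi(\cdot,t)\big\|_{A(\cdot,t)}^2\,dt \;+\; \alpha^{(1)}\mathcal{R}_1(\vec u^{(1)}) \;+\; \alpha^{(2)}\mathcal{R}_2(\vec u^{(2)}) \] attains a minimizer on \[ X := \{\vec u^{(1)}\in W^{1,2}(\Omega\times(0,1);\mathbb{R}^2) : \vec u^{(1)}(\cdot,1)=0\}\times L^2(\Omega\times(0,1);\mathbb{R}^2). \]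
   Context: Notation: $\vec x=(x_1,x_2)\in\Omega$, $t\in(0,1)$; $\nabla f=(\partial_{x_1}f,\partial_{x_2}f)^T$ is the spatial gradient, $f_t=\partial_t f$, and $\nabla_3=(\partial_{x_1},\partial_{x_2},\partial_t)^T$ the space–time gradient. For $\vec u^{(1)}=(u^{(1)}_1,u^{(1)}_2)$ and $\vec u^{(2)}=(u^{(2)}_1,u^{(2)}_2)$: - At each $(\vec x,t)$, $A_0:=\nabla f(\nabla f)^T\in\mathbb{R}^{2\times 2}$ and $A:=(A_0^TA_0+\varepsilon\,\mathrm{Id})^{1/2}$ (matrix square root via spectral decomposition), which is uniformly positive definite and continuous on $\overline\Omega\times[0,1]$. - $\vec\rho:=\frac{1}{|\nabla f|}(-f_t\,\partial_{x_1}f,\,-f_t\,\partial_{x_2}f)^T$ (set to $0$ where $\nabla f=0$), and $\vec\phi:=A^{-1/2}\vec\rho$. - For $\vec w\in L^2(\Omega;\mathbb{R}^2)$ and fixed $t$, $\|\vec w\|_{A(\cdot,t)}^2:=\int_\Omega \vec w(\vec x)^T A(\vec x,t)\,\vec w(\vec x)\,d\vec x$. - $\nu(r):=\varepsilon_\nu r+(1-\varepsilon_\nu)\lambda^2\big(\sqrt{1+r/\lambda^2}-1\big)$ for $r\ge 0$, and $\mathcal{R}_1(\vec u^{(1)}):=\int_{\Omega\times(0,1)}\nu\big(|\nabla_3 u^{(1)}_1|^2+|\nabla_3 u^{(1)}_2|^2\big)\,d\vec x\,dt$. - $\mathcal{R}_2(\vec u^{(2)}):=\int_{\Omega\times(0,1)}\Big|\int_0^t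 \vec u^{(2)}(\vec x,\tau)\,d\tau\Big|^2 d\vec x\,dt$ (a temporal $H^{-1}$-type norm). *)

(* Defs.v *)
From HB Require Import structures.
From mathcomp Require Import all_boot all_order all_algebra.
From mathcomp Require Import all_classical all_reals all_analysis.
Set Implicit Arguments. Unset Strict Implicit. Unset Printing Implicit Defensive.
Import Order.TTheory GRing.Theory Num.Theory.
Import numFieldNormedType.Exports.
Local Open Scope classical_set_scope.
Local Open Scope ring_scope.

Section Defs.
Variable R : realType.

Definition leb1 := @lebesgue_measure R.
Definition leb2 := (leb1 \x leb1)%E.
Definition leb3 := (leb2 \x leb1)%E.

Definition Omega : set (R * R) := `]0, 1[%classic `*` `]0, 1[%classic.
Definition Dom : set ((R * R) * R) := Omega `*` `]0, 1[%classic.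
Definition closedCube : set ((R * R) * R) :=
  (`[0, 1]%classic `*` `[0, 1]%classic) `*` `[0, 1]%classic.

Definition stfun := (R * R) -> R -> R.
Definition uncurry3 (g : stfun) : (R * R) * R -> R := fun z => g z.1 z.2.

(* partial derivatives: index 0 = x1, 1 = x2, 2 = t *)
Definition pline (g : stfun) (i : 'I_3) (x : R * R) (t : R) : R -> R :=
  fun s => if val i == 0%N then g (s, x.2) t
           else if val i == 1%N then g (x.1, s) t else g x s.
Definition pcoord (i : 'I_3) (x : R * R) (t : R) : R :=
  if val i == 0%N then x.1 else if val i == 1%N then x.2 else t.
Definition partial (g : stfun) (i : 'I_3) : stfun :=
  fun x t => derive1 (pline g i x t) (pcoord i x t).
Definition has_partial (g : stfun) (i : 'I_3) (x : R * R) (t : R) : Prop :=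
  derivable (pline g i x t) (pcoord i x t) 1.

(* f in C^1(closure(Omega) x [0,1]): f and its partials (which exist in the
   interior) extend continuously to the closed cube *)
Definition C1_closed (f : stfun) : Prop :=
  {within closedCube, continuous (uncurry3 f)} /\
  exists g : 'I_3 -> stfun,
    (forall i, {within closedCube, continuous (uncurry3 (g i))}) /\
    (forall i x t, Dom (x, t) -> has_partial f i x t /\ partial f i x t = g i x t).

Definition C1_fun (p : stfun) : Prop :=
  continuous (uncurry3 p) /\
  forall i, (forall x t, has_partial p i x t) /\ continuous (uncurry3 (partial p i)).

Definition test_fun (p : stfun) : Prop :=
  C1_fun p /\ exists d : R, 0 < d /\
    forall x t, p x t != 0 ->
      [/\ d <= x.1 <= 1 - d, d <= x.2 <= 1 - d & d <= t <= 1 - d].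

(* test functions vanishing near the lateral boundary and near t = 0, but
   not necessarily near t = 1 (used for the trace condition u(.,1) = 0) *)
Definition test_fun_top (p : stfun) : Prop :=
  C1_fun p /\ exists d : R, 0 < d /\
    forall x t, p x t != 0 ->
      [/\ d <= x.1 <= 1 - d, d <= x.2 <= 1 - d & d <= t].

Definition integ3 (h : stfun) : \bar R :=
  (\int[leb3]_(z in Dom) (uncurry3 h z)%:E)%E.

Definition L2 (u : stfun) : Prop :=
  measurable_fun Dom (uncurry3 u) /\
  (\int[leb3]_(z in Dom) ((uncurry3 u z) ^+ 2)%:E < +oo)%E.

Definition weak_grad (u : stfun) (g : 'I_3 -> stfun) : Prop :=
  forall (p : stfun) (i : 'I_3), test_fun p ->
    integ3 (fun x t => u x t * partial p i x t)
    = (- integ3 (fun x t => (g i x t * p x t)%R))%E.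

Definition W12 (u : stfun) (g : 'I_3 -> stfun) : Prop :=
  L2 u /\ (forall i, L2 (g i)) /\ weak_grad u g.

(* zero trace at t = 1 (Green's formula with test functions free at t = 1) *)
Definition trace_top_zero (u : stfun) (g : 'I_3 -> stfun) : Prop :=
  forall p : stfun, test_fun_top p ->
    integ3 (fun x t => u x t * partial p ord_max x t)
    = (- integ3 (fun x t => (g ord_max x t * p x t)%R))%E.

Definition vfield := 'I_2 -> stfun.

Definition Xadm (u1 : vfield) (G1 : 'I_2 -> 'I_3 -> stfun) (u2 : vfield) : Prop :=
  (forall j, W12 (u1 j) (G1 j) /\ trace_top_zero (u1 j) (G1 j)) /\
  (forall j, L2 (u2 j)).

(* matrix square root: the unique symmetric positive semidefinite root *)
Definition psd_sqrt_of (M S : 'M[R]_2) : Prop :=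
  S^T = S /\ (forall v : 'cV[R]_2, 0 <= (v^T *m S *m v) 0 0) /\ S *m S = M.
Definition sqrtm (M : 'M[R]_2) : 'M[R]_2 := xget 0 (psd_sqrt_of M).

Section Data.
Variables (f : stfun) (eps : R).

Definition gradf (x : R * R) (t : R) : 'cV[R]_2 :=
  \col_(i < 2) partial f (widen_ord (isT : (2 <= 3)%N) i) x t.
Definition ft (x : R * R) (t : R) : R := partial f ord_max x t.
Definition normgradf x t : R := Num.sqrt ((gradf x t 0 0) ^+ 2 + (gradf x t 1 0) ^+ 2).
Definition A0 x t : 'M[R]_2 := gradf x t *m (gradf x t)^T.
Definition Amat x t : 'M[R]_2 := sqrtm ((A0 x t)^T *m A0 x t + eps%:M).
Definition rho x t : 'cV[R]_2 :=
  if normgradf x t == 0 then 0 else (- ft x t / normgradf x t) *: gradf x t.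
Definition phi x t : 'cV[R]_2 := invmx (sqrtm (Amat x t)) *m rho x t.

Definition vec_at (u : vfield) x t : 'cV[R]_2 := \col_(j < 2) u j x t.

Definition data_term (u1 u2 : vfield) : \bar R :=
  (\int[leb1]_(t in `]0%R, 1%R[) \int[leb2]_(x in Omega)
     (let w := vec_at u1 x t + vec_at u2 x t - phi x t in
      (w^T *m Amat x t *m w) 0 0)%:E)%E.
End Data.

Definition nu (epsnu lam r : R) : R :=
  epsnu * r + (1 - epsnu) * lam ^+ 2 * (Num.sqrt (1 + r / lam ^+ 2) - 1).

Definition R1 (epsnu lam : R) (G1 : 'I_2 -> 'I_3 -> stfun) : \bar R :=
  integ3 (fun x t => nu epsnu lam (\sum_(j < 2) \sum_(i < 3) (G1 j i x t) ^+ 2)).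

Definition R2 (u2 : vfield) : \bar R :=
  integ3 (fun x t => \sum_(j < 2)
    (fine (\int[leb1]_(s in `[0%R, t]) (u2 j x s)%:E)%E) ^+ 2).

Definition Fs (f : stfun) (eps epsnu lam a1 a2 : R)
  (u1 : vfield) (G1 : 'I_2 -> 'I_3 -> stfun) (u2 : vfield) : \bar R :=
  (data_term f eps u1 u2 + a1%:E * R1 epsnu lam G1 + a2%:E * R2 u2)%E.

End Defs.

(* Main.v *)
Require Import Defs.
From HB Require Import structures.
From mathcomp Require Import all_boot all_order all_algebra.
From mathcomp Require Import all_classical all_reals all_analysis.
From mathcomp Require Import measurable_realfun real_interval.
From mathcomp Require Import ring lra.
Import Order.TTheory GRing.Theory Num.Theory.
Import numFieldNormedType.Exports.
Set Implicit Arguments. Unset Strict Implicit. Unset Printing Implicit Defensive.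
Local Open Scope classical_set_scope.
Local Open Scope ring_scope.

(** The functional is midpoint strongly convex in [u1 + u2] (because
    [A >= sqrt eps Id]) and in the space-time gradient of [u1] (because of the
    term [epsnu r] in [nu]).  The trace condition at [t = 1] gives the Poincare
    inequality [|u1| <= |d_t u1|] in L2, so strong convexity also controls [u1],
    and hence [u2], separately.  A minimising sequence with fast decreasing gap
    is therefore fast Cauchy in L2: it converges almost everywhere under an
    integrable majorant.  Green's formulas pass to the limit by dominated
    convergence, and Fatou's lemma gives lower semicontinuity.

    For the Poincare inequality, Green's formula tested on products of C1 bumps
    identifies [u1(x, t)] almost everywhere with minus the integral of [d_t u1]
    over [[t, 1]].  As [A0] has rank one, both [A] and [phi] have closed forms
    that are measurable in the entries of the gradient of [f]. *)

(** * Almost everywhere limits in L2 *)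

(** The delicate component is [u2]: [R2] measures only its time primitive, a negative norm that
    gives no L2 bound, so coercivity must come from coupling the three terms. A state is therefore
    handled as one flat family of L2 functions, [u1], its gradient [G1] and [u2], with Green's
    formulas as linear constraints between components; no derivative of a limit ever has to be
    taken. [R2] is also nonlocal in time: the energy density at a point depends on the earlier
    values of [u2]. Such time integrals are linear and continuous in the state only at almost every
    point, hence the almost everywhere form of the convexity and convergence statements. Test
    functions are only required to be C1, so explicit piecewise polynomial bumps suffice. A time
    bump replaced by its primitive need not vanish near t = 1; the trace condition is what makes it
    a legitimate test function. The matrix square root is picked by [xget], so nothing can be
    computed about [A] or [phi] before the positive semidefinite root is known to be unique. *)

Section geometric_steps.
Variable R : realType.

Lemma geometric_steps_bound (u : R^nat) (a : R) :
  (forall n, `|u n.+1 - u n| <= a * 2^-1 ^+ n) ->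
  forall n, `|u n - u 0%N| <= a * 2.
Proof.
move=> ua n; suff: `|u n - u 0%N| <= a * 2 * (1 - 2^-1 ^+ n).
  have a0 : 0 <= a by have := ua 0%N; rewrite expr0 mulr1; exact: le_trans.
  move=> /le_trans; apply; rewrite ler_piMr ?mulr_ge0// lerBlDr lerDl//.
elim: n => [|n ih]; first by rewrite expr0 !subrr mulr0 normr0.
have -> : u n.+1 - u 0%N = (u n.+1 - u n) + (u n - u 0%N) by ring.
apply: le_trans (ler_normD _ _) _; apply: le_trans (lerD (ua n) ih) _.
by rewrite exprS le_eqVlt; apply/orP; left; apply/eqP; field.
Qed.

Lemma geometric_steps_cvg (u : R^nat) (a : R) :
  (forall n, `|u n.+1 - u n| <= a * 2^-1 ^+ n) -> cvgn u.
Proof.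
move=> ua; pose d n := u n.+1 - u n.
have uE : u = (fun n => u 0%N + series d n).
  apply/funext => n; rewrite /series/= /d.
  by rewrite telescope_sumr// addrC subrK.
rewrite uE; apply: is_cvgD; first exact: is_cvg_cst.
apply: normed_cvg; apply: (@series_le_cvg _ _ (geometric a 2^-1)).
- by move=> n; rewrite /= normr_ge0.
- by move=> n; rewrite /= (le_trans (normr_ge0 _) (ua n)).
- by move=> n; exact: ua.
- by apply: is_cvg_geometric_series; rewrite ger0_norm; lra.
Qed.

End geometric_steps.

Section L2_limits.
Context d (T : measurableType d) (R : realType).
Variables (mu : {measure set T -> \bar R}) (D : set T) (mD : measurable D).

Lemma fast_cauchy_L2 (u : nat -> T -> R) (C : R) :
  (forall n, measurable_fun D (u n)) ->
  (\int[mu]_(x in D) ((u 0%N x) ^+ 2)%:E < +oo)%E ->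
  (forall n, \int[mu]_(x in D) ((u n.+1 x - u n x) ^+ 2)%:E
     <= (C * 16^-1 ^+ n)%:E)%E ->
  exists v M : T -> R, [/\ measurable_fun D v, mu.-integrable D (EFin \o M),
    {ae mu, forall x, D x -> u ^~ x @ \oo --> v x},
    {ae mu, forall x, D x -> forall n, (u n x) ^+ 2 <= M x} &
    {ae mu, forall x, D x -> (v x) ^+ 2 <= M x}].
Proof.
move=> mu_ u0 du.
(* Any weight strictly between 1 and 16 works; 4 leaves the ratio 1/4 for the integrals and, after a
   square root, 1/2 for the pointwise steps. *)
pose g n x := (4 ^+ n * (u n.+1 x - u n x) ^+ 2)%:E : \bar R.
have mg n : measurable_fun D (g n).
  apply/measurable_EFinP; apply: measurable_funM; first exact: measurable_cst.
  by apply: measurable_funX; exact: measurable_funB.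
have g0 n x : (0 <= g n x)%E.
  by rewrite lee_fin mulr_ge0 ?sqr_ge0// exprn_ge0.
pose S x := (\sum_(0 <= n <oo) g n x)%E.
have S0 x : (0 <= S x)%E by exact: nneseries_ge0.
have mS : measurable_fun D S by apply: ge0_emeasurable_sum.
have C0 : 0 <= C.
  have := le_trans (integral_ge0 _ _) (du 0%N).
  rewrite expr0 mulr1 lee_fin; apply => x _.
  by rewrite lee_fin sqr_ge0.
have iS : mu.-integrable D S.
  apply/integrableP; split => //.
  under eq_integral do rewrite gee0_abs//.
  rewrite integral_nneseries//.
  apply: (@le_lt_trans _ _ (\sum_(0 <= n <oo) (C * 4^-1 ^+ n)%:E)%E).
    apply: lee_nneseries => [n _ _|n _].
      by apply: integral_ge0 => x _; exact: g0.
    rewrite [X in (X <= _)%E](_ : _ = ((4 ^+ n)%:E *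
      \int[mu]_(x in D) ((u n.+1 x - u n x) ^+ 2)%:E)%E); last first.
      rewrite -ge0_integralZl_EFin ?exprn_ge0//.
        by move=> x _; rewrite lee_fin sqr_ge0.
      by apply/measurable_EFinP; apply: measurable_funX; exact: measurable_funB.
    apply: (@le_trans _ _ ((4 ^+ n)%:E * (C * 16^-1 ^+ n)%:E)%E).
      by rewrite lee_pmul2l// lte_fin exprn_gt0.
    rewrite -EFinM lee_fin mulrCA -exprMn.
    by rewrite (_ : 4 * 16^-1 = 4^-1 :> R)//; field.
  have cg : series (geometric C (4^-1 : R)) @ \oo --> C / (1 - 4^-1).
    by apply: cvg_geometric_series; rewrite ger0_norm; lra.
  rewrite (@cvg_lim _ _ _ _ _ _ ((C / (1 - 4^-1))%:E))// ?ltry//.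
  apply: cvg_EFin; first by apply: nearW => n; rewrite sumEFin.
  apply: cvg_trans cg; apply: near_eq_cvg; apply: nearW => n.
  by rewrite /= sumEFin.
pose E := D `&` [set x | (S x < +oo)%E].
have mE : measurable E by exact: emeasurable_fun_infty_o.
have fS x : E x -> S x = (fine (S x))%:E.
  by move=> [_ /= xoo]; rewrite fineK// ge0_fin_numE.
have steps x : E x -> forall n,
    `|u n.+1 x - u n x| <= Num.sqrt (fine (S x)) * 2^-1 ^+ n.
  move=> Ex n; have : (g n x <= S x)%E.
    rewrite /S (@nneseriesD1 _ _ n)//.
    by rewrite leeDl//; apply: nneseries_ge0.
  move=> gS; have {}gS : 4 ^+ n * (u n.+1 x - u n x) ^+ 2 <= fine (S x).
    by rewrite -lee_fin -fS.
  rewrite -ler_sqr ?nnegrE ?mulr_ge0 ?sqrtr_ge0 ?exprn_ge0//.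
  rewrite real_normK ?num_real// exprMn sqr_sqrtr ?fine_ge0// -exprM mulnC exprM.
  have -> : 2^-1 ^+ 2 = 4^-1 :> R by field.
  by rewrite exprVn ler_pdivlMr ?exprn_gt0// mulrC.
have cE x : E x -> cvgn (u ^~ x).
  by move=> Ex; exact: geometric_steps_cvg (steps x Ex).
(* Multiplying by the indicator of [E] makes the sequence converge at every point of [D], so that
   the limit is measurable. *)
pose h n x := u n x * \1_E x.
pose v x := limn (h ^~ x).
have ch x : D x -> h ^~ x @ \oo --> v x.
  move=> Dx; rewrite /v /h indicE; have [Ex|nEx] := boolP (x \in E).
    suff : cvgn (fun n => u n x * 1%:R) by [].
    under eq_fun do rewrite mulr1.
    by apply: cE; exact/set_mem.
  suff : cvgn (fun n => u n x * 0%:R) by [].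
  under eq_fun do rewrite mulr0.
  exact: is_cvg_cst.
have vE x : E x -> u ^~ x @ \oo --> v x.
  move=> Ex; have [Dx _] := Ex; move: (ch x Dx).
  by rewrite /h indicE mem_set//; under eq_fun do rewrite mulr1.
have aeE : {ae mu, forall x, D x -> E x}.
  apply: filterS (integrable_ae mD iS) => x Sx Dx; split => //=.
  by rewrite -ge0_fin_numE// Sx.
(* From |u_n - u_0| <= 2 sqrt S and (a + b)^2 <= 2 a^2 + 2 b^2. *)
pose M x := 2 * (u 0%N x) ^+ 2 + 8 * fine (S x).
have bM x : E x -> forall n, (u n x) ^+ 2 <= M x.
  move=> Ex n; have := geometric_steps_bound (steps x Ex) n.
  set s := Num.sqrt _ => us.
  have s2 : s ^+ 2 = fine (S x) by rewrite sqr_sqrtr// fine_ge0.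
  have : (u n x - u 0%N x) ^+ 2 <= (s * 2) ^+ 2.
    by rewrite -real_normK ?num_real// ler_sqr ?nnegrE// mulr_ge0// sqrtr_ge0.
  rewrite /M -s2 exprMn => h2.
  have -> : u n x = (u n x - u 0%N x) + u 0%N x by ring.
  have := sqr_ge0 ((u n x - u 0%N x) - u 0%N x).
  move: h2; set a := u n x - u 0%N x; set b := u 0%N x; move=> h2 h3.
  rewrite sqrrD; move: h3; rewrite sqrrB => h3; lra.
exists v, M; split.
- apply: (measurable_fun_cvg _ ch) => n.
  by apply: measurable_funM => //; exact: measurable_indic.
- rewrite (_ : EFin \o M = (fun x => (2 * (u 0%N x) ^+ 2)%:E + (8 * fine (S x))%:E)%E)//.
  apply: integrableD => //.
    apply/integrableP; split.
      apply/measurable_EFinP/measurable_funM; first exact: measurable_cst.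
      exact: measurable_funX.
    have u2 x : `|(2 * u 0%N x ^+ 2)%:E|%E = (2%:E * (u 0%N x ^+ 2)%:E)%E.
      by rewrite gee0_abs ?EFinM// lee_fin mulr_ge0// sqr_ge0.
    under eq_integral do rewrite u2.
    rewrite ge0_integralZl_EFin//.
      by rewrite lte_mul_pinfty.
      by move=> x _; rewrite lee_fin sqr_ge0.
    by apply/measurable_EFinP/measurable_funX.
  rewrite (_ : (fun x => _) = (fun x => 8%:E * (fine (S x))%:E)%E); last first.
    by apply/funext => x; rewrite EFinM.
  apply: integrableZl => //.
  apply: le_integrable iS => //.
    by apply/measurable_EFinP; exact: measurableT_comp.
  move=> x Dx; rewrite (gee0_abs (S0 x)) gee0_abs ?lee_fin ?fine_ge0//.
  by case: (S x) (S0 x) => [r| |]//= _; rewrite leey.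
- by apply: filterS aeE => x xE Dx; apply: vE; exact: xE.
- by apply: filterS aeE => x xE Dx; apply: bM; exact: xE.
- apply: filterS aeE => x /[apply] Ex.
  have c2 : (fun n => u n x ^+ 2) @ \oo --> v x ^+ 2.
    by rewrite expr2; under eq_fun do rewrite expr2; apply: cvgM; exact: vE.
  rewrite -(cvg_lim _ c2)//; apply: limr_le; first by apply/cvg_ex; exists (v x ^+ 2).
  by apply: nearW => n; exact: bM.
Qed.

(** Fatou's lemma along a convergent bound [b]: a minimising sequence comes with upper bounds on its
    energies. *)
Lemma fatou_ae_le (f : nat -> T -> R) (g : T -> R) (b : (\bar R)^nat) (l : \bar R) :
  (forall n, measurable_fun D (f n)) -> measurable_fun D g ->
  (forall n x, D x -> 0 <= f n x) -> (forall x, D x -> 0 <= g x) ->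
  {ae mu, forall x, D x -> f ^~ x @ \oo --> g x} ->
  (forall n, \int[mu]_(x in D) (f n x)%:E <= b n)%E -> b @ \oo --> l ->
  (\int[mu]_(x in D) (g x)%:E <= l)%E.
Proof.
move=> mf mg f0 g0 fg fb bl.
pose F n x := (f n x)%:E.
have mF n : measurable_fun D (F n) by exact/measurable_EFinP.
have := fatou mu mD mF (fun n x Dx => f0 n x Dx).
rewrite [X in (X <= _)%E -> _](_ : _ = \int[mu]_(x in D) (g x)%:E)%E; last first.
  apply: ge0_ae_eq_integral => //.
  - rewrite (_ : (fun x => _) =
        (fun x => - limn_esup (fun n => - F n x)))%E; last first.
      by apply/funext => x; rewrite -[X in limn_esup X]/(-%E \o (F ^~ x))
        limn_esupN oppeK.
    apply: measurableT_comp => //; apply: measurable_fun_limn_esup => n.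
    exact: measurableT_comp.
  - exact/measurable_EFinP.
  - move=> x Dx; rewrite limn_einf_lim.
    apply: lime_ge; first exact: is_cvg_einfs.
    apply: nearW => n; apply: le_ereal_inf_tmp => _ [k /= _ <-].
    by rewrite lee_fin f0.
  - apply: filterS fg => x fgx Dx.
    have cF : F ^~ x @ \oo --> (g x)%:E by apply: cvg_EFin (fgx Dx); apply: nearW.
    by rewrite is_cvg_limn_einfE ?(cvg_lim _ cF)//; apply/cvg_ex; exists (g x)%:E.
move=> /le_trans; apply.
have <- : limn_einf b = l.
  by rewrite is_cvg_limn_einfE ?(cvg_lim _ bl)//; apply/cvg_ex; exists l.
rewrite !limn_einf_lim; apply: lee_lim; [exact: is_cvg_einfs..|].
apply: nearW => n; apply: le_ereal_inf_tmp => _ [k /= nk <-].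
by apply: le_trans (fb k); apply: ereal_inf_lbound; exists k.
Qed.
End L2_limits.

(** * Square roots of rank-one shifts *)
Section matrix_square_root.
Variable R : realType.
Implicit Types (M S : 'M[R]_2) (g v w : 'cV[R]_2) (k c : R).

Lemma mx22P M S : M 0 0 = S 0 0 -> M 0 1 = S 0 1 -> M 1 0 = S 1 0 ->
  M 1 1 = S 1 1 -> M = S.
Proof.
move=> h00 h01 h10 h11; apply/matrixP => i j.
have ord2 (l : 'I_2) : l = 0 \/ l = 1.
  by case: l => -[|[|//]] ?; [left|right]; exact: val_inj.
by have [->|->] := ord2 i; have [->|->] := ord2 j.
Qed.

Lemma mulmx2E m n (A : 'M[R]_(m, 2)) (B : 'M[R]_(2, n)) i j :
  (A *m B) i j = A i 0 * B 0 j + A i 1 * B 1 j.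
Proof.
by rewrite mxE big_ord_recl big_ord1; congr (_ + A i _ * B _ j); exact: val_inj.
Qed.

Lemma quadform2E S v : (v^T *m S *m v) 0 0 =
  S 0 0 * v 0 0 ^+ 2 + (S 0 1 + S 1 0) * v 0 0 * v 1 0 + S 1 1 * v 1 0 ^+ 2.
Proof. by rewrite !mulmx2E !mxE; ring. Qed.

Definition colvec2 (a b : R) : 'cV[R]_2 := \col_i (if i == 0 then a else b).

Lemma psd_entries S : S^T = S -> (forall v, 0 <= (v^T *m S *m v) 0 0) ->
  [/\ 0 <= S 0 0, 0 <= S 1 1 & 0 <= S 0 0 * S 1 1 - S 0 1 ^+ 2].
Proof.
move=> symS psdS; have s10 : S 1 0 = S 0 1 by rewrite -[in LHS]symS mxE.
have q a b : 0 <= S 0 0 * a ^+ 2 + 2 * S 0 1 * a * b + S 1 1 * b ^+ 2.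
  by have := psdS (colvec2 a b); rewrite quadform2E !mxE/= s10 -mulr2n mulr_natl.
have p0 : 0 <= S 0 0 by have := q 1 0; lra.
have r0 : 0 <= S 1 1 by have := q 0 1; lra.
split => //; move: p0; rewrite le_eqVlt => /predU1P[p0|p0]; last first.
  (* This vector turns the form into S00 times the determinant. *)
  have := q (- S 0 1) (S 0 0).
  have -> : S 0 0 * (- S 0 1) ^+ 2 + 2 * S 0 1 * - S 0 1 * S 0 0 +
    S 1 1 * S 0 0 ^+ 2 = S 0 0 * (S 0 0 * S 1 1 - S 0 1 ^+ 2) by ring.
  by rewrite pmulr_rge0.
have -> : S 0 1 = 0.
  (* With S00 = 0 the form is affine in the first coordinate; this choice gives it the value - S11 -
     2. *)
  apply/eqP/negP => /negP h; have := q (- (S 1 1 + 1) / S 0 1) 1.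
  rewrite -p0 mul0r add0r expr1n !mulr1.
  have -> : 2 * S 0 1 * (- (S 1 1 + 1) / S 0 1) = - 2 * (S 1 1 + 1) by field.
  by lra.
by rewrite -p0 mul0r expr0n/= subr0.
Qed.

(* Cayley-Hamilton: a psd root S of M satisfies (tr S) S = M + (det S) I,
   and det S, tr S are determined by M through det M and tr M. *)
Lemma psd_sqrt_entries_unique (p q r p' q' r' : R) :
  0 <= p -> 0 <= r -> 0 <= p * r - q ^+ 2 ->
  0 <= p' -> 0 <= r' -> 0 <= p' * r' - q' ^+ 2 ->
  p * p + q * q = p' * p' + q' * q' -> p * q + q * r = p' * q' + q' * r' ->
  q * q + r * r = q' * q' + r' * r' -> [/\ p = p', q = q' & r = r'].
Proof.
move=> p0 r0 d0 p0' r0' d0' e00 e01 e11.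
have dd : p * r - q ^+ 2 = p' * r' - q' ^+ 2.
  apply/eqP; rewrite -(eqrXn2 (isT : 0 < 2)%N)//; apply/eqP.
  have -> : (p * r - q ^+ 2) ^+ 2 = (p * p + q * q) * (q * q + r * r) -
    (p * q + q * r) ^+ 2 by ring.
  have -> : (p' * r' - q' ^+ 2) ^+ 2 = (p' * p' + q' * q') * (q' * q' + r' * r')
    - (p' * q' + q' * r') ^+ 2 by ring.
  by rewrite e00 e11 e01.
have tt : p + r = p' + r'.
  apply/eqP; rewrite -(eqrXn2 (isT : 0 < 2)%N) ?addr_ge0//; apply/eqP.
  have -> : (p + r) ^+ 2 = (p * p + q * q) + (q * q + r * r) +
    2 * (p * r - q ^+ 2) by ring.
  have -> : (p' + r') ^+ 2 = (p' * p' + q' * q') + (q' * q' + r' * r') +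
    2 * (p' * r' - q' ^+ 2) by ring.
  by rewrite e00 e11 dd.
have [t0|t0] := eqVneq (p + r) 0.
  have [zp zr zp' zr'] : [/\ p = 0, r = 0, p' = 0 & r' = 0] by split; lra.
  move: d0 d0'; rewrite zp zp' zr zr' !mul0r => d0 d0'; split => //.
  have -> : q = 0 by apply/eqP; rewrite -sqrf_eq0; apply/eqP; have := sqr_ge0 q; lra.
  by apply/esym/eqP; rewrite -sqrf_eq0; apply/eqP; have := sqr_ge0 q'; lra.
have e (a b : R) : (p + r) * a = (p + r) * b -> a = b by move/(mulfI t0).
split; apply: e.
- have -> : (p + r) * p = (p * p + q * q) + (p * r - q ^+ 2) by ring.
  by rewrite e00 dd tt; ring.
- by have -> : (p + r) * q = p * q + q * r by [ring]; rewrite e01 tt; ring.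
- have -> : (p + r) * r = (q * q + r * r) + (p * r - q ^+ 2) by ring.
  by rewrite e11 dd tt; ring.
Qed.

Lemma psd_sqrt_unique M S S' : psd_sqrt_of M S -> psd_sqrt_of M S' -> S = S'.
Proof.
move=> [symS [psdS SM]] [symS' [psdS' SM']].
have [p0 r0 d0] := psd_entries symS psdS.
have [p0' r0' d0'] := psd_entries symS' psdS'.
have s10 : S 1 0 = S 0 1 by rewrite -[in LHS]symS mxE.
have s10' : S' 1 0 = S' 0 1 by rewrite -[in LHS]symS' mxE.
have E i j : (S *m S) i j = (S' *m S') i j by rewrite SM SM'.
move: (E 0 0) (E 0 1) (E 1 1); rewrite !mulmx2E s10 s10' => e00 e01 e11.
have [h00 h01 h11] := psd_sqrt_entries_unique p0 r0 d0 p0' r0' d0' e00 e01 e11.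
by apply: mx22P; rewrite ?s10 ?s10'.
Qed.

(** [sqrtm] is a choice among roots, so exhibiting a root determines it only through uniqueness. *)
Lemma sqrtmE M S : psd_sqrt_of M S -> sqrtm M = S.
Proof.
by move=> MS; apply: (psd_sqrt_unique _ MS); apply: xgetPex; exists S.
Qed.

Definition rank1_shift k c g : 'M[R]_2 := k *: (g *m g^T) + c%:M.

Definition sqnorm2 g : R := g 0 0 ^+ 2 + g 1 0 ^+ 2.

Lemma sqnorm2_ge0 g : 0 <= sqnorm2 g.
Proof. by rewrite addr_ge0 ?sqr_ge0. Qed.

(** With n = |g|^2, the root has eigenvalue sqrt c across g and sqrt (c + k n) along g, so its
    coefficient is (sqrt (c + k n) - sqrt c) / n. Rationalising the quotient keeps it meaningful at
    g = 0. *)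
Definition sqrt_coef k c n : R := k / (Num.sqrt c + Num.sqrt (c + k * n)).

Lemma rank1_shift_quadform k c g w : (w^T *m rank1_shift k c g *m w) 0 0 =
  k * (g 0 0 * w 0 0 + g 1 0 * w 1 0) ^+ 2 + c * sqnorm2 w.
Proof.
rewrite quadform2E /rank1_shift /sqnorm2 !mxE !big_ord1 !mxE/= !mulr1n !mulr0n.
by ring.
Qed.

Lemma sqrtm_rank1_shift k c g : 0 <= k -> 0 < c ->
  sqrtm (rank1_shift k c g) =
  rank1_shift (sqrt_coef k c (sqnorm2 g)) (Num.sqrt c) g.
Proof.
move=> k0 c0; apply: sqrtmE; have N0 := sqnorm2_ge0 g.
have kN0 : 0 <= k * sqnorm2 g by rewrite mulr_ge0.
set s1 := Num.sqrt c; have s10 : 0 < s1 by rewrite sqrtr_gt0.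
rewrite /sqrt_coef; set s2 := Num.sqrt (c + _).
have s20 : 0 < s2 by rewrite sqrtr_gt0 ltr_pwDl.
have k'0 : 0 <= k / (s1 + s2) by rewrite divr_ge0// addr_ge0// ltW.
split; first by rewrite /rank1_shift linearD/= linearZ/= trmx_mul trmxK tr_scalar_mx.
split; first by move=> v; rewrite rank1_shift_quadform addr_ge0// mulr_ge0
  ?sqr_ge0 ?sqnorm2_ge0// ltW.
have s1s : s1 ^+ 2 = c by rewrite sqr_sqrtr// ltW.
have s2s : s2 ^+ 2 = c + k * sqnorm2 g by rewrite sqr_sqrtr// addr_ge0// ltW.
have key : k / (s1 + s2) * (k / (s1 + s2) * sqnorm2 g + 2 * s1) = k.
  have -> : k / (s1 + s2) * sqnorm2 g = s2 - s1.
    have -> : k / (s1 + s2) * sqnorm2 g = (k * sqnorm2 g) / (s1 + s2) by ring.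
    have -> : k * sqnorm2 g = s2 ^+ 2 - s1 ^+ 2 by rewrite s1s s2s; ring.
    by field; lra.
  by field; lra.
move: key; set k' := k / _ => key.
apply: mx22P; rewrite mulmx2E /rank1_shift !mxE !big_ord1 !mxE/= !mulr1n !mulr0n
  -?s1s -[in RHS]key /sqnorm2; ring.
Qed.

(** [g] is an eigenvector for k |g|^2 + c; invertibility is witnessed by the Sherman-Morrison
    inverse. *)
Lemma invmx_rank1_shift k c g : 0 <= k -> 0 < c ->
  invmx (rank1_shift k c g) *m g = (k * sqnorm2 g + c)^-1 *: g.
Proof.
move=> k0 c0; have N0 := sqnorm2_ge0 g.
have kN0 : 0 <= k * sqnorm2 g by rewrite mulr_ge0.
have n0 : k * sqnorm2 g + c != 0 by rewrite gt_eqF// ltr_wpDl.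
have uS : rank1_shift k c g \in unitmx.
  have := @mulmx1_unit _ _ (rank1_shift k c g)
    (rank1_shift (- k / (c * (k * sqnorm2 g + c))) c^-1 g).
  case=> //; move: n0; rewrite /sqnorm2 => n0.
  by apply: mx22P; rewrite mulmx2E /rank1_shift !mxE !big_ord1 !mxE/= !mulr1n !mulr0n;
    field; rewrite n0 gt_eqF.
have Sg : rank1_shift k c g *m g = (k * sqnorm2 g + c) *: g.
  apply/matrixP => i j; rewrite mulmx2E /rank1_shift !mxE !big_ord1 !mxE !ord1.
  have ord2 (l : 'I_2) : l = 0 \/ l = 1.
    by case: l => -[|[|//]] ?; [left|right]; exact: val_inj.
  by have [->|->] := ord2 i; rewrite /= !mulr1n !mulr0n /sqnorm2; ring.
rewrite -[X in invmx _ *m X](scale1r g) -(mulVf n0) -scalerA -Sg -scalemxAr.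
by rewrite mulKmx.
Qed.

End matrix_square_root.

(** * Closed forms of the data term *)

Section data_integrand.
Variables (R : realType) (f : stfun R) (eps : R).
Hypothesis eps0 : 0 < eps.

(** Since A0 = g g^T, the matrix A0^T A0 is |g|^2 g g^T: the coefficient of the rank-one part is n =
    |g|^2 itself, whence the repeated argument. *)
Definition aniso (n : R) := sqrt_coef n eps n.
(** The last denominator is the eigenvalue of A^(1/2) along the gradient. At n = 0 the value is 0,
    because the inverse of 0 is 0; this agrees with the case split in [rho]. *)
Definition phi_coef (h n : R) : R :=
  - h / Num.sqrt n /
  (sqrt_coef (aniso n) (Num.sqrt eps) n * n + Num.sqrt (Num.sqrt eps)).

Lemma aniso_ge0 n : 0 <= n -> 0 <= aniso n.
Proof. by move=> n0; rewrite divr_ge0// addr_ge0 ?sqrtr_ge0. Qed.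

Lemma AmatE x t :
  Amat f eps x t = rank1_shift (aniso (sqnorm2 (gradf f x t))) (Num.sqrt eps) (gradf f x t).
Proof.
rewrite /Amat -sqrtm_rank1_shift ?sqnorm2_ge0//; congr sqrtm.
rewrite /A0 trmx_mul trmxK /rank1_shift; congr (_ + _).
set g := gradf f x t.
rewrite -mulmxA (mulmxA g^T) (_ : g^T *m g = (sqnorm2 g)%:M).
  by rewrite mul_scalar_mx scalemxAr.
apply/matrixP => i j; rewrite !ord1 mulmx2E /sqnorm2 !mxE /= mulr1n !expr2.
by [].
Qed.

Lemma data_integrandE x t (w : 'cV[R]_2) : (w^T *m Amat f eps x t *m w) 0 0 =
  aniso (sqnorm2 (gradf f x t)) *
    (gradf f x t 0 0 * w 0 0 + gradf f x t 1 0 * w 1 0) ^+ 2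
  + Num.sqrt eps * sqnorm2 w.
Proof. by rewrite AmatE rank1_shift_quadform. Qed.

Lemma phiE x t : phi f eps x t =
  phi_coef (ft f x t) (sqnorm2 (gradf f x t)) *: gradf f x t.
Proof.
have N0 := sqnorm2_ge0 (gradf f x t).
rewrite /phi AmatE sqrtm_rank1_shift ?aniso_ge0 ?sqrtr_gt0// /rho.
rewrite /normgradf -/(sqnorm2 _); case: ifPn => [/eqP n0|n0].
  rewrite mulmx0; apply/esym/matrixP => i j; rewrite !mxE /phi_coef n0 invr0.
  by rewrite mulr0 !mul0r.
rewrite -scalemxAr invmx_rank1_shift ?scalerA// ?sqrtr_gt0 ?sqrtr_gt0//.
by rewrite divr_ge0 ?aniso_ge0// addr_ge0 ?sqrtr_ge0.
Qed.

End data_integrand.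

(** * Measurability of roots and inverses *)

Section measurability.
Context d (T : measurableType d) (R : realType).
Implicit Types (D : set T) (f : T -> R).

Lemma measurable_fun_sqrt D f :
  measurable_fun D f -> measurable_fun D (fun x => Num.sqrt (f x)).
Proof.
move=> mf; apply: measurableT_comp => //.
by apply: continuous_measurable_fun; exact: sqrt_continuous.
Qed.

(** Inversion is discontinuous at 0, a value reached where the gradient of [f] vanishes. The power
    function of exponent -1 is measurable and agrees with inversion on nonnegative arguments. *)
Lemma measurable_fun_inv_ge0 D f : measurable_fun D f ->
  (forall x, D x -> 0 <= f x) -> measurable_fun D (fun x => (f x)^-1).
Proof.
move=> mf f0; apply: (eq_measurable_fun (fun x => f x `^ (-1))).
  by move=> x; rewrite inE => Dx; rewrite powR_inv1// f0.
exact: (measurableT_comp (@measurable_powR R (-1)) mf).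
Qed.

End measurability.

(** * Continuous functions on the closed cube *)

Section cube.
Variable R : realType.
Local Notation Z := ((R * R) * R)%type.
Implicit Types (g : Z -> R) (z : Z).

Lemma measurable_Dom : measurable (@Dom R).
Proof. by apply: measurableX => //; exact: measurableX. Qed.

Lemma Dom_subset_closedCube : @Dom R `<=` @closedCube R.
Proof.
move=> z [[]]; rewrite /= !in_itv/= => /andP[a b] /andP[c e] /andP[h i].
by split; [split|]; rewrite /= in_itv/= !ltW.
Qed.

(** Half-open, so that the cells of one grid are disjoint and leave no gap in the open unit
    interval. *)
Definition cell (N : nat) (i : 'I_N) : set R :=
  `[i%:R / N%:R, i.+1%:R / N%:R[%classic.

Lemma cellP (N : nat) (s : R) : 0 < s < 1 -> (0 < N)%N ->
  exists i : 'I_N, cell i s.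
Proof.
move=> /andP[s0 s1] N0; have N0' : 0 < N%:R :> R by rewrite ltr0n.
have iN : (Num.truncn (s * N%:R) < N)%N.
  rewrite -(ltr_nat R); apply: le_lt_trans (_ : s * N%:R < _).
    by rewrite truncn_le mulr_ge0 ?ltW.
  by rewrite gtr_pMl.
exists (Ordinal iN); rewrite /cell /= in_itv/= ler_pdivrMr// ltr_pdivlMr//.
by rewrite truncn_le ?mulr_ge0 ?ltW//= truncnS_gt.
Qed.

Lemma cell_inj (N : nat) (i j : 'I_N) (s : R) : cell i s -> cell j s -> i = j.
Proof.
move=> hi hj; have N0 : 0 < N%:R :> R by rewrite ltr0n (leq_ltn_trans _ (ltn_ord i)).
move: hi hj; rewrite /cell /= !in_itv/= !ler_pdivrMr// !ltr_pdivlMr// => h1 h2.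
by apply: val_inj => /=; rewrite -(truncn_def h1) -(truncn_def h2).
Qed.

Definition node (N : nat) (i : 'I_N * 'I_N * 'I_N) : Z :=
  ((i.1.1%:R / N%:R, i.1.2%:R / N%:R), i.2%:R / N%:R).
Definition box (N : nat) (i : 'I_N * 'I_N * 'I_N) : set Z :=
  (cell i.1.1 `*` cell i.1.2) `*` cell i.2.

Lemma boxP (N : nat) z : Dom z -> (0 < N)%N ->
  exists i : 'I_N * 'I_N * 'I_N, box i z.
Proof.
move=> [[]]; rewrite /= !in_itv/= => z1 z2 z3 N0.
have [i zi] := cellP z1 N0; have [j zj] := cellP z2 N0.
have [k zk] := cellP z3 N0.
by exists (i, j, k).
Qed.

Lemma box_inj (N : nat) (i j : 'I_N * 'I_N * 'I_N) z :
  box i z -> box j z -> i = j.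
Proof.
move: i j => [[i1 i2] i3] [[j1 j2] j3] [[/= a b] c] [[/= a' b'] c'].
by rewrite (cell_inj a a') (cell_inj b b') (cell_inj c c').
Qed.

Definition step_approx g (N : nat) z : R :=
  \sum_(i : 'I_N * 'I_N * 'I_N) g (node i) * \1_(box i) z.

Lemma step_approxE g N (i : 'I_N * 'I_N * 'I_N) z :
  box i z -> step_approx g N z = g (node i).
Proof.
move=> iz; rewrite /step_approx (bigD1 i)//= indicE mem_set// mulr1 big1 ?addr0//.
move=> j ji; rewrite indicE memNset ?mulr0// => jz.
by move/eqP: ji; apply; exact: box_inj jz iz.
Qed.

Lemma measurable_box N (i : 'I_N * 'I_N * 'I_N) : measurable (box i).
Proof. by apply: measurableX; [apply: measurableX|]; exact: measurable_itv. Qed.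

Lemma measurable_step_approx g N : measurable_fun setT (step_approx g N).
Proof.
apply: measurable_sum => i; apply: measurable_funM => //.
by apply: measurable_indic; exact: measurable_box.
Qed.

Lemma cell_cvg (s : R) (q : R^nat) :
  (forall n, exists i : 'I_n.+1, cell i s /\ q n = i%:R / n.+1%:R) ->
  q @ \oo --> s.
Proof.
move=> qs; apply: (@squeeze_cvgr _ _ _ _ (fun n => s - n.+1%:R^-1) (cst s)).
- apply: nearW => n; have [i [+ ->]] := qs n.
  rewrite /cell /= in_itv/= => /andP[-> h]; rewrite andbT lerBlDr.
  by rewrite -[X in _ + X]mul1r -mulrDl natr1 ltW.
- rewrite -[X in _ --> X]subr0; apply: cvgB; first exact: cvg_cst.
  exact: cvg_harmonic.
- exact: cvg_cst.
Qed.

Lemma node_cvg z (i : forall n, 'I_n.+1 * 'I_n.+1 * 'I_n.+1) :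
  (forall n, box (i n) z) -> node (i n) @[n --> \oo] --> z.
Proof.
case: z => -[z1 z2] z3 iz.
apply: (@cvg_pair _ _ _ _ (nbhs (z1, z2)) (nbhs z3)).
  apply: (@cvg_pair _ _ _ _ (nbhs z1) (nbhs z2)); apply: cell_cvg => n;
    by have [[/= a b] c] := iz n; eexists; split; [eassumption|].
by apply: cell_cvg => n; have [[/= a b] c] := iz n; eexists; split; [eassumption|].
Qed.

(** Continuity holds only relative to the closed cube, and measurability refers to a product
    sigma-algebra. Step functions sampling [g] at the lower corners of a grid meet both: the corners
    stay in the closed cube and tend to the given point. *)
Lemma continuous_closedCube_measurable g :
  {within @closedCube R, continuous g} -> measurable_fun (@Dom R) g.
Proof.
move=> cg; apply: (@measurable_fun_cvg _ _ _ _ (fun n => step_approx g n.+1)).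
  by move=> n; apply: measurable_funTS; exact: measurable_step_approx.
move=> z Dz.
have [i iz] : exists i : forall n, 'I_n.+1 * 'I_n.+1 * 'I_n.+1,
    forall n, box (i n) z.
  exists (fun n => projT1 (cid (boxP Dz (ltn0Sn n)))) => n.
  exact: (projT2 (cid (boxP Dz (ltn0Sn n)))).
under eq_fun do rewrite (step_approxE g (iz _)).
have pz := node_cvg iz.
have pA n : closedCube (node (i n)).
  have c01 (k : 'I_n.+1) : 0 <= (k%:R / n.+1%:R : R) <= 1.
    by rewrite divr_ge0//= ler_pdivrMr// mul1r ler_nat ltnW.
  by split; [split|]; rewrite /= in_itv/= c01.
have /subspace_continuousP/(_ z (Dom_subset_closedCube Dz)) := cg.
apply: cvg_comp => U; rewrite /within/= => zU.
by apply: (@filterS nat \oo _ _ _ _ (pz _ zU)) => n /(_ (pA n)).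
Qed.

Lemma continuous_closedCube_bounded g :
  {within @closedCube R, continuous g} ->
  exists2 K, 0 <= K & forall z, closedCube z -> `|g z| <= K.
Proof.
move=> cg; have cc : compact (@closedCube R).
  by apply: compact_setX; [apply: compact_setX|]; exact: segment_compact.
have [M [_ MP]] := compact_bounded (continuous_compact cg cc).
exists (Num.max 0 (M + 1)); first by rewrite le_max lexx.
move=> z zc; apply: le_trans (MP (M + 1) _ _ _) _.
- by rewrite ltrDl.
- by exists z.
- by rewrite le_max lexx orbT.
Qed.

End cube.

(** * Bump functions *)
Section bumps.
Variable R : realType.
Implicit Types (a s t y : R) (f : R -> R).

Definition C1R f (f' : R -> R) : Prop :=
  (forall s, is_derive s 1 f (f' s)) /\ continuous f'.

Lemma C1R_continuous f f' : C1R f f' -> continuous f.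
Proof.
move=> [df _] s; apply: differentiable_continuous; apply/derivable1_diffP.
by have [] := df s.
Qed.

Lemma C1R_mul f f' g g' : C1R f f' -> C1R g g' ->
  C1R (fun s => f s * g s) (fun s => f s * g' s + g s * f' s).
Proof.
move=> Cf Cg; have cf := C1R_continuous Cf; have cg := C1R_continuous Cg.
case: Cf Cg => df cf' [dg cg']; split; first by move=> s; apply: is_deriveM.
by move=> s; apply: cvgD; apply: cvgM; [exact: cf|exact: cg'|exact: cg|exact: cf'].
Qed.

Lemma C1R_comp_affine f f' (c e : R) : C1R f f' ->
  C1R (fun s => f (c * s + e)) (fun s => f' (c * s + e) * c).
Proof.
move=> [df cf']; split => s.
  have da : is_derive s 1 (fun s => c * s + e) c.
    by apply: is_derive_eq; rewrite ?addr0 ?scaler0 ?addr0 [_ *: _]mulr1.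
  exact: (@is_derive1_comp _ f (fun s => c * s + e)).
have ca : {for s, continuous (fun s => c * s + e)}.
  by apply: cvgD; [apply: cvgM; [exact: cvg_cst|exact: cvg_id]|exact: cvg_cst].
apply: cvgM; last exact: cvg_cst.
by apply: (@continuous_comp _ _ _ (fun s => c * s + e) f'); [exact: ca|exact: cf'].
Qed.

Lemma C1R_onem_expn f f' n : C1R f f' ->
  C1R (fun s => 1 - (1 - f s) ^+ n) (fun s => n%:R * (1 - f s) ^+ n.-1 * f' s).
Proof.
move=> Cf; have cf := C1R_continuous Cf; case: Cf => df cf'.
have c1 : continuous (fun s => 1 - f s).
  by move=> s; apply: cvgB; [exact: cvg_cst|exact: cf].
split => s.
  have d1 : is_derive s 1 (fun s => 1 - f s) (- f' s).
    by rewrite -[X in is_derive _ _ _ X]add0r; apply: is_deriveB.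
  have d2 := is_deriveX n d1.
  rewrite (_ : (fun s => _) = cst 1 - (fun s => 1 - f s) ^+ n); last first.
    by apply/funext => y; rewrite !fctE.
  by apply: is_derive_eq; rewrite sub0r scalerN opprK.
apply: cvgM; last exact: cf'.
apply: cvgM; first exact: cvg_cst.
by apply: (@continuous_comp _ _ _ (fun s => 1 - f s) (fun y => y ^+ n.-1));
  [exact: c1|exact: exprn_continuous].
Qed.

(** A C1 function vanishing exactly on a half-line, from which compactly supported C1 bumps are
    multiplied together. *)
Definition sqpos y : R := Num.max 0 y ^+ 2.

Lemma sqpos_ge0 y : 0 <= sqpos y. Proof. exact: sqr_ge0. Qed.

Lemma sqpos_le0 y : y <= 0 -> sqpos y = 0.
Proof. by move=> y0; rewrite /sqpos max_l// expr0n. Qed.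

Lemma sqpos_gt0 y : 0 < y -> sqpos y = y ^+ 2.
Proof. by move=> y0; rewrite /sqpos max_r// ltW. Qed.

Lemma sqpos_le y z : y <= z -> sqpos y <= sqpos z.
Proof.
move=> yz; have [y0|y0] := leP y 0; first by rewrite (sqpos_le0 y0) sqpos_ge0.
have z0 := lt_le_trans y0 yz.
by rewrite !sqpos_gt0// ler_sqr ?nnegrE ?(ltW y0) ?(ltW z0).
Qed.

Lemma max0_continuous : continuous (fun y : R => Num.max 0 y).
Proof.
have -> : (fun y : R => Num.max 0 y) = (fun y => (y + `|y|) / 2).
  by apply/funext => z; rewrite maxr_absE add0r sub0r normrN.
move=> y; apply: cvgM; last exact: cvg_cst.
by apply: cvgD; [exact: cvg_id|exact: norm_continuous].
Qed.

Lemma sqpos_C1 : C1R sqpos (fun y => 2 * Num.max 0 y).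
Proof.
split=> y; last by apply: cvgM; [exact: cvg_cst|exact: max0_continuous].
have [y0|y0|->] := ltgtP y 0.
- rewrite mulr0; apply: (@near_eq_is_derive _ _ _ (cst 0)).
    near=> z; rewrite /= sqpos_le0// ltW//; near: z.
    exact: lt_nbhsl.
- apply: (@near_eq_is_derive R R R (fun z : R => z * z)).
    near=> z; rewrite sqpos_gt0 ?expr2//; near: z.
    exact: lt_nbhsr.
  by apply: is_derive_eq; rewrite [_ *: _]mulr1 mulr_natl mulr2n.
- rewrite mulr0.
  (* At the origin the difference quotient is bounded by |h| from either side. *)
  have h0 : h^-1 *: (sqpos (h *: 1 + 0) - sqpos 0) @[h --> (0:R)^'] --> (0:R).
    apply/cvgrPdist_le => e e0; near=> h.
    have hn : h != 0 by near: h; exact: nbhs_dnbhs_neq.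
    have he : `|h| <= e by near: h; exact: dnbhs0_le.
    rewrite addr0 [h *: 1]mulr1 (sqpos_le0 (lexx 0)) subr0 sub0r normrN.
    apply: le_trans he; rewrite [_ *: _]mulrC.
    have [h0|h0] := leP h 0; first by rewrite sqpos_le0// mul0r normr0.
    by rewrite sqpos_gt0// expr2 mulfK.
  split; first by apply/cvg_ex; exists 0.
  by rewrite /derive; apply/cvg_lim.
Unshelve. all: by end_near. Qed.

Definition bump_base a (e : R) s : R := sqpos (s - (a + e)) * sqpos (1 - e - s).

(** The power sends 1 - b to 0 where the base b stays away from 0, and leaves it equal to 1 where b
    = 0; the bumps thus tend to an indicator without normalisation. The margin 1/(n+1) keeps each
    support inside the open interval. *)
Definition bump a n s : R := 1 - (1 - bump_base a n.+1%:R^-1 s) ^+ n.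

Lemma bump_C1 a n : exists f', C1R (bump a n) f'.
Proof.
have C1 := C1R_comp_affine 1 (- (a + n.+1%:R^-1)) sqpos_C1.
have C2 := C1R_comp_affine (- 1) (1 - n.+1%:R^-1) sqpos_C1.
have := C1R_onem_expn n (C1R_mul C1 C2).
rewrite (_ : (fun s => 1 - _) = bump a n); first by move=> h; eexists; exact: h.
apply/funext => s; rewrite /bump /bump_base; move: (n.+1%:R^-1) => e.
by congr (1 - (1 - sqpos _ * sqpos _) ^+ n); ring.
Qed.

Lemma bump_base_ge0 a e s : 0 <= bump_base a e s.
Proof. by rewrite mulr_ge0// sqpos_ge0. Qed.

Lemma bump_base_supp a e s : bump_base a e s != 0 -> a + e <= s <= 1 - e.
Proof.
rewrite /bump_base; have [h|h] := leP (s - (a + e)) 0.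
  by rewrite sqpos_le0// mul0r eqxx.
have [h2|h2 _] := leP (1 - e - s) 0.
  by rewrite [sqpos (1 - _ - _)]sqpos_le0// mulr0 eqxx.
by apply/andP; split; lra.
Qed.

Lemma sqpos_le1 y : y <= 1 -> sqpos y <= 1.
Proof. by move=> /sqpos_le /le_trans; apply; rewrite sqpos_gt0// expr1n. Qed.

Lemma bump_base_le1 a e s : 0 <= a -> 0 <= e -> bump_base a e s <= 1.
Proof.
move=> a0 e0; have [->//|/bump_base_supp /andP[h1 h2]] := eqVneq (bump_base a e s) 0.
rewrite /bump_base -[leRHS]mulr1 ler_pM ?sqpos_ge0//; apply: sqpos_le1; lra.
Qed.

Lemma invn_ge0 n : 0 <= n.+1%:R^-1 :> R.
Proof. by rewrite invr_ge0. Qed.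

Lemma bump_supp a n s : bump a n s != 0 -> a + n.+1%:R^-1 <= s <= 1 - n.+1%:R^-1.
Proof.
move=> h; apply: bump_base_supp; apply: contra h => /eqP h.
by rewrite /bump h subr0 expr1n subrr.
Qed.

Lemma bump_itv a n s : 0 <= a -> 0 <= bump a n s <= 1.
Proof.
move=> a0; have h0 := bump_base_ge0 a n.+1%:R^-1 s.
have h1 := bump_base_le1 s a0 (invn_ge0 n).
have g0 : 0 <= 1 - bump_base a n.+1%:R^-1 s by rewrite subr_ge0.
rewrite /bump subr_ge0 exprn_ile1//=; last by rewrite lerBlDr lerDl.
by rewrite lerBlDr lerDl exprn_ge0.
Qed.

Lemma bump_cvg a s : 0 <= a ->
  bump a n s @[n --> \oo] --> (\1_(`]a, 1[%classic) s : R).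
Proof.
move=> a0; rewrite indicE; case: (boolP (s \in _)); last first.
  rewrite notin_setE/= in_itv/= => h.
  have -> : (fun n => bump a n s) = cst 0.
    apply/funext => n; apply/eqP/negP => /negP /bump_supp; apply: contra_not h.
    have : 0 < n.+1%:R^-1 :> R by rewrite invr_gt0.
    by move: (n.+1%:R^-1) => e e0 /andP[h1 h2]; apply/andP; split; lra.
  exact: cvg_cst.
rewrite inE/= in_itv/= => /andP[h1 h2].
(* Half of each distance to the endpoints is reserved for the margin: [c] bounds the base from below
   as soon as 1/(n+1) is at most both halves. *)
pose c := sqpos ((s - a) / 2) * sqpos ((1 - s) / 2).
have c0 : 0 < c.
  by rewrite mulr_gt0// sqpos_gt0 ?exprn_gt0//; lra.
have hn : \forall n \near \oo, c <= bump_base a n.+1%:R^-1 s.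
  have [m [m0 ms m1]] : exists m, [/\ 0 < m, m <= (s - a) / 2 & m <= (1 - s) / 2].
    exists (Num.min ((s - a) / 2) ((1 - s) / 2)).
    by rewrite lt_min !ge_min !lexx orbT; split => //; apply/andP; split; lra.
  have : \forall n \near \oo, n.+1%:R^-1 <= m.
    have /cvgrPdist_le/(_ m m0) := @cvg_harmonic R.
    by apply: filterS => n; rewrite sub0r normrN ger0_norm ?harmonic_ge0.
  apply: filterS => n; move: (n.+1%:R^-1) => e em.
  by rewrite ler_pM ?sqpos_ge0// sqpos_le//; lra.
have c1 : c <= 1.
  by rewrite /c -[leRHS]mulr1 ler_pM ?sqpos_ge0//; apply: sqpos_le1; lra.
rewrite -[X in _ --> X]subr0; apply: cvgB; first exact: cvg_cst.
apply: (@squeeze_cvgr _ _ _ _ (cst 0) (fun n => (1 - c) ^+ n)).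
- apply: filterS hn => n cn.
  have g0 : 0 <= 1 - bump_base a n.+1%:R^-1 s.
    by rewrite subr_ge0 bump_base_le1// invn_ge0.
  rewrite exprn_ge0//= lerXn2r ?nnegrE ?subr_ge0 ?c1//.
    by rewrite -subr_ge0.
  by rewrite lerB.
- exact: cvg_cst.
- by apply: cvg_expr; rewrite ger0_norm; lra.
Qed.

(** Starting at -oo makes the fundamental theorem of calculus available at every [t]. The primitive
    is constant beyond t = 1, which [test_fun_top] permits. *)
Definition bump_prim a n t : R :=
  (\int[lebesgue_measure]_(s in `]-oo, t]) bump a n s)%R.

Lemma bump_continuous a n : continuous (bump a n).
Proof. by have [f'] := bump_C1 a n; exact: C1R_continuous. Qed.

Lemma bump_integrable a n : 0 <= a ->
  lebesgue_measure.-integrable setT (EFin \o bump a n).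
Proof.
move=> a0.
have : lebesgue_measure.-integrable `[0, 1]%classic (EFin \o bump a n).
  by apply: continuous_compact_integrable; [exact: segment_compact|
    apply: continuous_subspaceT; exact: bump_continuous].
rewrite integrable_mkcond//; congr (lebesgue_measure.-integrable _ _).
apply/funext => s; rewrite patchE; case: ifPn => //.
rewrite notin_setE/= in_itv/= => h; apply/esym/eqP; rewrite /= eqe.
apply/negP => /negP /bump_supp; apply: contra_not h.
have : 0 < n.+1%:R^-1 :> R by rewrite invr_gt0.
by move: (n.+1%:R^-1) => e e0 /andP[h1 h2]; apply/andP; split; lra.
Qed.

Lemma bump_prim_C1 a n : 0 <= a -> C1R (bump_prim a n) (bump a n).
Proof.
move=> a0; split; last exact: bump_continuous.
move=> s; have := @continuous_FTC1 R (bump a n) -oo%O s (s + 1).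
case=> //.
- by rewrite ltrDl.
- by apply: integrableS (bump_integrable n a0).
- by rewrite ltNyr.
- exact: bump_continuous.
- by move=> dF F'; split; [exact: dF|rewrite -derive1E; exact: F'].
Qed.

Lemma bump_prim_supp a n t : 0 <= a -> bump_prim a n t != 0 -> n.+1%:R^-1 <= t.
Proof.
move=> a0; apply: contra_neqT; rewrite -ltNge => tn.
rewrite /bump_prim /Rintegral integral0_eq// => s /=; rewrite in_itv/= => st.
apply/eqP; rewrite eqe; apply/negP => /negP /bump_supp /andP[+ _].
by move: (n.+1%:R^-1) tn => e tn h1; lra.
Qed.

End bumps.

(** * Square integrability on a set of finite measure *)

Section generic_measure.
Context d (T : measurableType d) (R : realType).
Variables (mu : {measure set T -> \bar R}) (D : set T) (mD : measurable D).

Lemma integrable_sqr_integrable (u : T -> R) : (mu D < +oo)%E ->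
  measurable_fun D u -> (\int[mu]_(x in D) ((u x) ^+ 2)%:E < +oo)%E ->
  mu.-integrable D (EFin \o u).
Proof.
move=> Doo mu_ u2.
have mu2 : measurable_fun D (fun x => (u x ^+ 2)%:E).
  by apply/measurable_EFinP; exact: measurable_funX.
apply: (@le_integrable _ _ _ mu D mD _ (fun x => (1 + u x ^+ 2)%:E)).
- exact/measurable_EFinP.
- move=> x _ /=; rewrite lee_fin [leRHS]ger0_norm ?addr_ge0 ?sqr_ge0//.
  rewrite -real_normK ?num_real//; have := sqr_ge0 (`|u x| - 1).
  by rewrite sqrrB1; have := normr_ge0 (u x); lra.
- rewrite (_ : (fun x => _) = (fun x => 1%:E + (u x ^+ 2)%:E)%E)//.
  apply: integrableD => //.
    apply/integrableP; split; first exact: measurable_cst.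
    by under eq_integral do rewrite gee0_abs//; rewrite integral_cst// mul1e.
  apply/integrableP; split => //.
  by under eq_integral do rewrite gee0_abs ?lee_fin ?sqr_ge0//.
Qed.

Lemma integrable_mulr_bounded (u b : T -> R) (K : R) :
  mu.-integrable D (EFin \o u) -> measurable_fun D b ->
  (forall x, D x -> `|b x| <= K) -> mu.-integrable D (EFin \o (fun x => u x * b x)).
Proof.
move=> iu mb bK; have mu_ : measurable_fun D u.
  by apply/measurable_EFinP; exact: measurable_int iu.
apply: (@le_integrable _ _ _ mu D mD _ (fun x => (K%:E * (u x)%:E)%E)).
- by apply/measurable_EFinP; exact: measurable_funM.
- move=> x Dx /=; rewrite lee_fin !normrM mulrC ler_wpM2r//.
  exact: le_trans (bK x Dx) (ler_norm _).
- exact: integrableZl.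
Qed.

End generic_measure.

(** * Sections of a product measure *)

Section product_sections.
Context d1 d2 (X : measurableType d1) (Y : measurableType d2) (R : realType).
Variables (m : {sigma_finite_measure set X -> \bar R}).
Variables (n : {sigma_finite_measure set Y -> \bar R}).

Lemma ae_fst (A : X -> Prop) : {ae m, forall x, A x} ->
  {ae (m \x n)%E, forall z : X * Y, A z.1}.
Proof.
move=> [N [mN N0 AN]]; exists (N `*` setT); split.
- exact: measurableX.
- transitivity (m N * n setT)%E; first exact: product_measure1E.
  by rewrite N0 mul0e.
- by move=> z /= Az; split => //; exact: AN.
Qed.

(** By Tonelli, almost every section of a null set is null. *)
Lemma ae_section (A : X * Y -> Prop) : {ae (m \x n)%E, forall z, A z} ->
  {ae m, forall x, {ae n, forall y, A (x, y)}}.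
Proof.
move=> [N [mN N0 AN]].
have mx := @measurable_fun_xsection _ _ X Y R n N mN.
have : ae_eq m setT (fun x => n (xsection N x)) (cst 0%E).
  apply/ae_eq_integral_abs => //; rewrite -[RHS]N0 /product_measure1.
  by apply: eq_integral => x _; rewrite gee0_abs.
apply: filterS => x /(_ I) /= nx; exists (xsection N x); split => //.
  exact: measurable_xsection.
by move=> y /= Ay; rewrite /xsection /= inE; exact: AN.
Qed.

(** An integral is by definition the difference of the integrals of the two parts, each measurable
    in [x] by Tonelli, so a signed [K] is allowed. *)
Lemma measurable_fun_integral_section (K : X * Y -> \bar R) :
  measurable_fun setT K ->
  measurable_fun setT (fun x => \int[n]_y K (x, y))%E.
Proof.
move=> mK.
rewrite (_ : (fun x => _) = (fun x => \int[n]_y (K^\+ (x, y)) - \int[n]_y (K^\- (x, y)))%E).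
  apply: emeasurable_funB.
    by apply: (@measurable_fun_fubini_tonelli_F _ _ _ _ _ n (K^\+)%E) => //;
      exact: measurable_funepos.
  by apply: (@measurable_fun_fubini_tonelli_F _ _ _ _ _ n (K^\-)%E) => //;
    exact: measurable_funeneg.
apply/funext => x; rewrite [LHS]integralE.
under eq_integral do rewrite funepos_comp/=.
by under [X in (_ - X = _)%E]eq_integral do rewrite funeneg_comp/=.
Qed.

End product_sections.

(** * Volterra integrals in time *)
Section volterra_line.
Variable R : realType.
Local Notation leb := (@lebesgue_measure R).
Implicit Types (k : pred R) (c : R -> R).

(** A predicate instead of a bound lets one theory serve both the past integral of [R2] (s <= t) and
    the tail integral of the Poincare inequality (t <= s). *)
Definition cutoff k c (s : R) : R := if k s then c s else 0.

Lemma cutoff_le k c s : `|cutoff k c s| <= `|c s|.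
Proof. by rewrite /cutoff; case: ifPn; rewrite ?normr0. Qed.

Lemma measurable_cutoff k c : measurable_fun setT k -> measurable_fun setT c ->
  measurable_fun setT (cutoff k c).
Proof. by move=> mk mc; exact: measurable_fun_ifT. Qed.

Lemma integrable_cutoff k c : measurable_fun setT k ->
  leb.-integrable setT (EFin \o c) -> leb.-integrable setT (EFin \o cutoff k c).
Proof.
move=> mk ic; have mc : measurable_fun setT c.
  by apply/measurable_EFinP; exact: measurable_int ic.
apply: le_integrable ic => //.
  by apply/measurable_EFinP; exact: measurable_cutoff.
by move=> s _; rewrite /= lee_fin cutoff_le.
Qed.

Definition cutint k c : R := fine (\int[leb]_s (cutoff k c s)%:E)%E.

Lemma cutintE k c : measurable_fun setT k -> leb.-integrable setT (EFin \o c) ->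
  ((cutint k c)%:E = \int[leb]_s (cutoff k c s)%:E)%E.
Proof.
by move=> mk ic; rewrite /cutint fineK//; apply: integrable_fin_num => //;
  exact: integrable_cutoff.
Qed.

Lemma cutint_norm_le k c : measurable_fun setT k ->
  leb.-integrable setT (EFin \o c) ->
  `|cutint k c| <= fine (\int[leb]_s `|c s|%:E)%E.
Proof.
move=> mk ic; have mc : measurable_fun setT c.
  by apply/measurable_EFinP; exact: measurable_int ic.
have c0 : (0 <= \int[leb]_s `|c s|%:E)%E by apply: integral_ge0 => s _; rewrite lee_fin.
have coo : (\int[leb]_s `|c s|%:E < +oo)%E by have /integrableP[] := ic.
rewrite -lee_fin fineK ?ge0_fin_numE//.
rewrite -[X in (X <= _)%E]/(`|(cutint k c)%:E|%E) cutintE//.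
apply: le_trans (le_abse_integral _ _ _) _ => //.
  by apply/measurable_EFinP; exact: measurable_cutoff.
apply: ge0_le_integral => //.
- by apply/measurable_EFinP; apply: measurableT_comp => //; exact: measurable_cutoff.
- by apply/measurable_EFinP; exact: measurableT_comp.
- by move=> s _; rewrite lee_fin cutoff_le.
Qed.

(** Cauchy-Schwarz on an interval of length one. If [c] is not square integrable, the right-hand
    side is infinite. *)
Lemma cutint_sqr_le k c : measurable_fun setT k -> measurable_fun setT c ->
  (forall s, ~ (0 < s < 1) -> c s = 0) ->
  ((cutint k c ^+ 2)%:E <= \int[leb]_s (c s ^+ 2)%:E)%E.
Proof.
move=> mk mc c0; pose I01 : set R := `]0, 1[%classic.
have mI : measurable I01 by exact: measurable_itv.
have c2E : (\int[leb]_s (c s ^+ 2)%:E = \int[leb]_(s in I01) (c s ^+ 2)%:E)%E.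
  rewrite [RHS]integral_mkcond; apply: eq_integral => s _; rewrite patchE.
  case: ifPn => //; rewrite notin_setE /I01/= in_itv/= => h.
  by rewrite c0// expr0n.
have [->|] := eqVneq (\int[leb]_s (c s ^+ 2)%:E)%E +oo%E; first by rewrite leey.
rewrite -ltey => c2oo.
have l01 : leb I01 = 1%:E by rewrite /I01 lebesgue_measure_itv/= lte01 sube0.
have l01oo : (leb I01 < +oo)%E by rewrite l01 ltry.
have ic01 : leb.-integrable I01 (EFin \o c).
  apply: integrable_sqr_integrable => //.
  - exact: measurable_funTS.
  - by rewrite -c2E.
have ic : leb.-integrable setT (EFin \o c).
  move: ic01; rewrite integrable_mkcond//; congr (leb.-integrable _ _).
  apply/funext => s; rewrite patchE; case: ifPn => //.
  by rewrite notin_setE /I01/= in_itv/= => /c0 ->.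
have aE : (\int[leb]_s `|c s|%:E = \int[leb]_(s in I01) `|c s|%:E)%E.
  rewrite [RHS]integral_mkcond; apply: eq_integral => s _; rewrite patchE.
  case: ifPn => //; rewrite notin_setE /I01/= in_itv/= => h.
  by rewrite c0// normr0.
have aoo : (\int[leb]_s `|c s|%:E < +oo)%E by have /integrableP[] := ic.
pose a := fine (\int[leb]_s `|c s|%:E)%E.
have aEa : (\int[leb]_s `|c s|%:E = a%:E)%E.
  by rewrite fineK// ge0_fin_numE// integral_ge0// => s _; rewrite lee_fin.
have a0 : 0 <= a by rewrite fine_ge0// integral_ge0// => s _; rewrite lee_fin.
have ka : `|cutint k c| <= a by exact: cutint_norm_le.
have -> : cutint k c ^+ 2 = `|cutint k c| ^+ 2 by rewrite real_normK ?num_real.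
apply: (@le_trans _ _ (a ^+ 2)%:E).
  by rewrite lee_fin ler_sqr.
(* integrate 2 a |c| <= c^2 + a^2 over the unit interval *)
have key : ((2 * a)%:E * a%:E <= \int[leb]_s (c s ^+ 2)%:E + (a ^+ 2)%:E)%E.
  rewrite -aEa aE c2E -ge0_integralZl_EFin//; last 2 first.
  - by apply/measurable_EFinP; apply: measurableT_comp => //; exact: measurable_funTS.
  - by rewrite mulr_ge0.
  have -> : ((a ^+ 2)%:E = \int[leb]_(s in I01) (a ^+ 2)%:E)%E.
    by rewrite integral_cst// -[X in (_ * X)%E]/(leb I01) l01 mule1.
  rewrite -ge0_integralD//; last 3 first.
  - by move=> s _; rewrite lee_fin sqr_ge0.
  - by apply/measurable_EFinP; apply: measurable_funX; exact: measurable_funTS.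
  - by move=> s _; rewrite lee_fin sqr_ge0.
  apply: ge0_le_integral => //.
  - by move=> s _; rewrite -EFinM lee_fin !mulr_ge0.
  - apply/measurable_EFinP; apply: measurable_funM => //.
    by apply: measurableT_comp => //; exact: measurable_funTS.
  - apply/measurable_EFinP; apply: measurable_funD => //.
    by apply: measurable_funX; exact: measurable_funTS.
  - move=> s _; rewrite -EFinM -EFinD lee_fin -(real_normK (num_real (c s))).
    by have := sqr_ge0 (`|c s| - a); rewrite sqrrB; lra.
have c2f : (\int[leb]_s (c s ^+ 2)%:E)%E \is a fin_num.
  by rewrite ge0_fin_numE// integral_ge0// => s _; rewrite lee_fin sqr_ge0.
move: key; rewrite -(fineK c2f) -EFinM -EFinD !lee_fin; nra.
Qed.

Lemma cutint_cvg k (u : nat -> R -> R) (v M : R -> R) : measurable_fun setT k ->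
  (forall n, measurable_fun setT (u n)) -> measurable_fun setT v ->
  leb.-integrable setT (EFin \o M) ->
  {ae leb, forall s, u ^~ s @ \oo --> v s} ->
  {ae leb, forall s n, `|u n s| <= M s} ->
  cutint k (u n) @[n --> \oo] --> cutint k v.
Proof.
move=> mk mu_ mv iM uv uM.
have ? : Filter (nbhs (almost_everywhere leb)) := ae_filter_ringOfSetsType leb.
have [|||||iv _ cv] := @dominated_convergence _ _ R leb setT measurableT
  (fun n s => (cutoff k (u n) s)%:E) (fun s => (cutoff k v s)%:E) (EFin \o M).
- by move=> n; apply/measurable_EFinP; exact: measurable_cutoff.
- by apply/measurable_EFinP; exact: measurable_cutoff.
- apply: filterS uv => s us _; apply: cvg_EFin; first exact: nearW.
  rewrite /cutoff /=; case: ifPn => _; first exact: us.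
  exact: cvg_cst.
- exact: iM.
- apply: filterS uM => s us n _; rewrite /= lee_fin.
  exact: le_trans (cutoff_le _ _ _) (us n).
rewrite /cutint; apply: fine_cvg; rewrite fineK//.
exact: integrable_fin_num iv.
Qed.

Lemma cutintD k (u v : R -> R) (a b : R) : measurable_fun setT k ->
  leb.-integrable setT (EFin \o u) -> leb.-integrable setT (EFin \o v) ->
  cutint k (fun s => a * u s + b * v s) = a * cutint k u + b * cutint k v.
Proof.
move=> mk iu iv; have := (cutintE mk iu, cutintE mk iv) => -[eu ev].
apply: EFin_inj; rewrite EFinD !EFinM eu ev /cutint fineK; last first.
  apply: integrable_fin_num => //; apply: integrable_cutoff => //.
  rewrite (_ : EFin \o _ = (fun s => a%:E * (u s)%:E + b%:E * (v s)%:E)%E)//.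
  by apply: integrableD => //; exact: integrableZl.
rewrite -!integralZl//; [|exact: integrable_cutoff..].
rewrite -integralD//; [|by apply: integrableZl => //; exact: integrable_cutoff..].
apply: eq_integral => s _; rewrite -!EFinM -EFinD /cutoff.
by case: ifPn; rewrite ?mulr0 ?addr0.
Qed.

(* Integration by parts against a primitive, as Fubini on a triangle. *)
Lemma cutint_swap (c e : R -> R) :
  leb.-integrable setT (EFin \o c) -> leb.-integrable setT (EFin \o e) ->
  (\int[leb]_t (c t * cutint (fun s => s <= t) e)%:E =
   \int[leb]_s (e s * cutint (fun t => s <= t) c)%:E)%E.
Proof.
move=> ic ie.
have mc : measurable_fun setT c.
  by apply/measurable_EFinP; exact: measurable_int ic.
have me : measurable_fun setT e.
  by apply/measurable_EFinP; exact: measurable_int ie.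
have mk t : measurable_fun setT (fun s : R => s <= t).
  exact: measurable_fun_ler.
have mk' s : measurable_fun setT (fun t : R => s <= t).
  exact: measurable_fun_ler.
pose K (w : R * R) := (if w.2 <= w.1 then c w.1 * e w.2 else 0)%:E : \bar R.
have mK : measurable_fun setT K.
  apply/measurable_EFinP; apply: measurable_fun_ifT => //.
    exact: measurable_fun_ler.
  by apply: measurable_funM; [exact: measurableT_comp|exact: measurableT_comp].
have iK : (leb \x leb)%E.-integrable setT K.
  apply/integrable12ltyP => //.
  apply: (@le_lt_trans _ _ (\int[leb]_t (`|c t|%:E * \int[leb]_s `|e s|%:E))%E).
    apply: ge0_le_integral => //.
    - by move=> t _; apply: integral_ge0.
    - apply: (@measurable_fun_fubini_tonelli_F _ _ _ _ R leb (abse \o K)).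
        exact: measurableT_comp.
      by move=> w; exact: abse_ge0.
    - by apply: emeasurable_funM => //; apply/measurable_EFinP; exact: measurableT_comp.
    - move=> t _; rewrite -ge0_integralZl_EFin//; last first.
        by apply/measurable_EFinP; exact: measurableT_comp.
      apply: ge0_le_integral => //.
      + by apply: measurableT_comp => //; exact: measurableT_comp.
      + by apply/measurable_EFinP; apply: measurable_funM => //; exact: measurableT_comp.
      + move=> s _; rewrite /K /= -EFinM lee_fin -normrM.
        by case: ifPn => // _; rewrite normr0.
  have /integrableP[_ coo] := ic; have /integrableP[_ eoo] := ie.
  have [ef|] := boolP ((\int[leb]_s `|e s|%:E)%E \is a fin_num); last first.
    by rewrite ge0_fin_numE ?eoo// integral_ge0// => s _; rewrite lee_fin.
  rewrite -(fineK ef); under eq_integral do rewrite muleC.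
  rewrite ge0_integralZl_EFin//; last 2 first.
  - by apply/measurable_EFinP; exact: measurableT_comp.
  - by rewrite fine_ge0// integral_ge0// => s _; rewrite lee_fin.
  by rewrite lte_mul_pinfty// lee_fin fine_ge0// integral_ge0// => s _; rewrite lee_fin.
have := Fubini iK; rewrite /fubini_F /fubini_G /K /= => FE.
transitivity (\int[leb]_t \int[leb]_s (if s <= t then c t * e s else 0)%:E)%E.
  apply: eq_integral => t _; rewrite EFinM cutintE// -integralZl//; last exact: integrable_cutoff.
  apply: eq_integral => s _; rewrite -EFinM /cutoff; case: ifPn => //; by rewrite mulr0.
rewrite FE; apply: eq_integral => s _.
rewrite EFinM cutintE// -integralZl//; last exact: integrable_cutoff.
apply: eq_integral => t _; rewrite -EFinM /cutoff mulrC.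
by case: ifPn => // _; rewrite mulr0.
Qed.

End volterra_line.

(** * Products of bumps as test functions *)

Section product_test_functions.
Variable R : realType.
Implicit Types a b c : R -> R.
Local Notation Z := ((R * R) * R)%type.

Definition prod3 a b c : stfun R := fun x t => a x.1 * b x.2 * c t.

Lemma prod3_continuous a b c : continuous a -> continuous b -> continuous c ->
  continuous (uncurry3 (prod3 a b c)).
Proof.
move=> ca cb cc z; rewrite /uncurry3 /prod3.
apply: cvgM; [apply: cvgM|].
- apply: (@continuous_comp _ _ _ (fun z : Z => z.1.1) a); last exact: ca.
  by apply: (@continuous_comp _ _ _ (fst : Z -> R * R) fst); exact: cvg_fst.
- apply: (@continuous_comp _ _ _ (fun z : Z => z.1.2) b); last exact: cb.
  by apply: (@continuous_comp _ _ _ (fst : Z -> R * R) snd); [exact: cvg_fst|exact: cvg_snd].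
- by apply: (@continuous_comp _ _ _ (snd : Z -> R) c); [exact: cvg_snd|exact: cc].
Qed.

Definition prod3_partial a a' b b' c c' (i : 'I_3) : stfun R :=
  if val i == 0%N then prod3 a' b c
  else if val i == 1%N then prod3 a b' c else prod3 a b c'.

Lemma prod3_is_derive a a' b b' c c' i x t :
  C1R a a' -> C1R b b' -> C1R c c' ->
  is_derive (pcoord i x t) 1 (pline (prod3 a b c) i x t)
    (prod3_partial a a' b b' c c' i x t).
Proof.
move=> [da _] [db _] [dc _]; case: i => -[|[|[|//]]] i3.
- rewrite /pcoord /pline /prod3_partial /prod3 /=.
  have h := da x.1; apply: is_derive_eq.
  by rewrite !scaler0 !add0r; rewrite /GRing.scale/=; ring.
- rewrite /pcoord /pline /prod3_partial /prod3 /=.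
  have h := db x.2; apply: is_derive_eq.
  by rewrite !scaler0 ?add0r ?addr0; rewrite /GRing.scale/=; ring.
- rewrite /pcoord /pline /prod3_partial /prod3 /=.
  have h := dc t; apply: is_derive_eq.
  by rewrite ?scaler0 ?add0r ?addr0; rewrite /GRing.scale/=; ring.
Qed.

Lemma prod3_partialE a a' b b' c c' i :
  C1R a a' -> C1R b b' -> C1R c c' ->
  partial (prod3 a b c) i = prod3_partial a a' b b' c c' i.
Proof.
move=> Ca Cb Cc; apply/funext => x; apply/funext => t.
have h := prod3_is_derive i x t Ca Cb Cc.
by rewrite /partial derive1E derive_val.
Qed.

Lemma prod3_C1 a a' b b' c c' : C1R a a' -> C1R b b' -> C1R c c' ->
  C1_fun (prod3 a b c).
Proof.
move=> Ca Cb Cc.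
have [[ca cb] cc] := (C1R_continuous Ca, C1R_continuous Cb, C1R_continuous Cc).
split; first exact: prod3_continuous.
move=> i; split.
  by move=> x t; have [] := prod3_is_derive i x t Ca Cb Cc.
rewrite (prod3_partialE i Ca Cb Cc) /prod3_partial.
have [[[_ ca'] [_ cb']] [_ cc']] := (Ca, Cb, Cc).
by case: ifPn => _; [|case: ifPn => _]; exact: prod3_continuous.
Qed.

(** In time the bump is replaced by its primitive, so that the time derivative is again a full
    product of bumps. Green's formula for this function comes from the trace condition, since it
    need not vanish near t = 1. *)
Lemma bump_test_fun_top (a1 a2 a3 : R) n : 0 <= a1 -> 0 <= a2 -> 0 <= a3 ->
  test_fun_top (prod3 (bump a1 n) (bump a2 n) (bump_prim a3 n)).
Proof.
move=> a10 a20 a30; split.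
  have [[b1 C1] [b2 C2]] := (bump_C1 a1 n, bump_C1 a2 n).
  exact: prod3_C1 C1 C2 (bump_prim_C1 n a30).
exists n.+1%:R^-1; split; first by rewrite invr_gt0.
move=> x t; rewrite /prod3 !mulf_eq0 !negb_or => /andP[/andP[h1 h2] h3].
have /andP[l1 r1] := bump_supp h1; have /andP[l2 r2] := bump_supp h2.
split.
- by rewrite r1 andbT (le_trans _ l1)// lerDr.
- by rewrite r2 andbT (le_trans _ l2)// lerDr.
- exact: bump_prim_supp h3.
Qed.

Lemma bump_test_partial (a1 a2 a3 : R) n : 0 <= a3 ->
  partial (prod3 (bump a1 n) (bump a2 n) (bump_prim a3 n)) ord_max =
  prod3 (bump a1 n) (bump a2 n) (bump a3 n).
Proof.
move=> a30; have [[b1 C1] [b2 C2]] := (bump_C1 a1 n, bump_C1 a2 n).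
by rewrite (prod3_partialE _ C1 C2 (bump_prim_C1 n a30)).
Qed.

Lemma bump_primE (a : R) n t : bump_prim a n t = cutint (fun s => s <= t) (bump a n).
Proof.
rewrite /bump_prim /Rintegral /cutint integral_mkcond; congr fine.
apply: eq_integral => s _; rewrite patchE /cutoff /=.
have -> : (s \in `]-oo, t]%classic) = (s <= t).
  by apply/idP/idP; rewrite inE/= in_itv/=.
by case: ifPn.
Qed.

End product_test_functions.

(** * Volterra integrals on a product space *)

Section volterra.
Context dX (X : measurableType dX) (R : realType).
Variable m : {sigma_finite_measure set X -> \bar R}.
Local Notation leb := (@lebesgue_measure R).
Implicit Types (k : R -> R -> bool) (u : X * R -> R) (z : X * R).

Definition volterra k u z : R := cutint (k z.2) (fun s => u (z.1, s)).

Definition measurable_rel k := measurable_fun setT (fun w : R * R => k w.1 w.2).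

Lemma measurable_rel_line k t : measurable_rel k -> measurable_fun setT (k t).
Proof. by move=> mk; exact: (measurable_fun_pair2 t mk). Qed.

Lemma measurable_rel_ge : measurable_rel (fun t s => s <= t).
Proof. exact: measurable_fun_ler. Qed.

Lemma measurable_rel_le : measurable_rel (fun t s => t <= s).
Proof. exact: measurable_fun_ler. Qed.

Lemma measurable_volterra k u : measurable_rel k -> measurable_fun setT u ->
  measurable_fun setT (volterra k u).
Proof.
move=> mk mu_.
pose K (w : (X * R) * R) := (if k w.1.2 w.2 then u (w.1.1, w.2) else 0)%:E : \bar R.
have mK : measurable_fun setT K.
  apply/measurable_EFinP; apply: measurable_fun_ifT => //.
    apply: (measurableT_comp mk (_ : measurable_fun setT (fun w : (X * R) * R => (w.1.2, w.2)))).
    by apply: measurable_fun_pair => //; exact: measurableT_comp.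
  apply: (measurableT_comp mu_ (_ : measurable_fun setT (fun w : (X * R) * R => (w.1.1, w.2)))).
  by apply: measurable_fun_pair => //; exact: measurableT_comp.
have := @measurable_fun_integral_section _ _ _ _ _ leb K mK.
move=> mI; apply: (measurableT_comp _ mI).
exact: fine_measurable.
Qed.

Lemma measurable_section u x : measurable_fun setT u ->
  measurable_fun setT (fun s => u (x, s)).
Proof. exact: measurable_fun_pair2. Qed.

Lemma ae_integrable_section u : (m \x leb)%E.-integrable setT (EFin \o u) ->
  {ae (m \x leb)%E, forall z : X * R,
    leb.-integrable setT (EFin \o (fun s => u (z.1, s)))}.
Proof.
move=> iu; apply: (@ae_fst _ _ _ _ _ m leb
  (fun x => leb.-integrable setT (EFin \o (fun s => u (x, s))))).
exact: (ae_integrable1 iu).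
Qed.

(** The bound of [cutint_sqr_le] is uniform in [t], and integrating it over a time interval of
    length one costs nothing. This produces the constant 1 of the Poincare inequality. *)
Lemma volterra_sqr_integral (O : set X) k u : measurable O -> measurable_rel k ->
  measurable_fun setT u -> (forall z, ~ (0 < z.2 < 1) -> u z = 0) ->
  (\int[m \x leb]_(z in O `*` `]0%R, 1%R[) (volterra k u z ^+ 2)%:E <=
   \int[m \x leb]_z (u z ^+ 2)%:E)%E.
Proof.
move=> mO mk mu_ u0; pose I01 : set R := `]0, 1[%classic.
have mI : measurable I01 by exact: measurable_itv.
have l01 : leb I01 = 1%E by rewrite /I01 lebesgue_measure_itv/= lte01 sube0.
have mu2 : measurable_fun setT (fun z => (u z ^+ 2)%:E).
  by apply/measurable_EFinP; exact: measurable_funX.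
have u20 z : (0 <= (u z ^+ 2)%:E)%E by rewrite lee_fin sqr_ge0.
pose h x := (\int[leb]_s (u (x, s) ^+ 2)%:E)%E.
have mh : measurable_fun setT h.
  exact: (@measurable_fun_fubini_tonelli_F _ _ _ _ _ leb (fun z => (u z ^+ 2)%:E)).
have h0 x : (0 <= h x)%E by apply: integral_ge0 => s _; rewrite lee_fin sqr_ge0.
rewrite [leRHS](@fubini_tonelli1 _ _ _ _ _ m leb (fun z => (u z ^+ 2)%:E))//.
pose K z := (h z.1 * (\1_I01 z.2)%:E)%E.
have mK : measurable_fun setT K.
  apply: emeasurable_funM; first exact: measurableT_comp.
  by apply/measurable_EFinP; apply: measurableT_comp.
have K0 z : (0 <= K z)%E by rewrite mule_ge0// lee_fin.
apply: (@le_trans _ _ (\int[m \x leb]_z K z)%E); last first.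
  rewrite (@fubini_tonelli1 _ _ _ _ _ m leb K)//; apply: ge0_le_integral => //.
  - by move=> x _; apply: integral_ge0.
  - exact: (@measurable_fun_fubini_tonelli_F _ _ _ _ _ leb K).
  - move=> x _; rewrite /fubini_F /K /=.
    rewrite ge0_integralZl//; last by apply/measurable_EFinP; exact: measurable_indic.
    by rewrite integral_indic// setIT -[X in (_ * X)%E]/(leb I01) l01 mule1.
rewrite integral_mkcond; apply: ge0_le_integral => //.
- by move=> z _; rewrite patchE; case: ifPn => // _; rewrite lee_fin sqr_ge0.
- apply/(measurable_restrict _ _ measurableT) => //; first exact: measurableX.
  rewrite setTI; apply: measurable_funTS; apply/measurable_EFinP.
  by apply: measurable_funX; exact: measurable_volterra.
- move=> [x t] _; rewrite patchE; case: ifPn => // /set_mem[/= Ox It].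
  rewrite /K /= indicE mem_set// mule1.
  apply: cutint_sqr_le.
  + exact: measurable_rel_line.
  + exact: measurable_section.
  + by move=> s s01; apply: u0.
Qed.

End volterra.

(** * Measures given by a density *)

Section density_measure.
Context d (T : measurableType d) (R : realType).
Variables (mu : {measure set T -> \bar R}) (f : T -> \bar R).

(* The proofs are arguments so that the measure structure can be inferred. *)
Definition density_measure (_ : measurable_fun setT f)
  (_ : forall x, (0 <= f x)%E) (A : set T) : \bar R := (\int[mu]_(x in A) f x)%E.

Hypotheses (mf : measurable_fun setT f) (f0 : forall x, (0 <= f x)%E).

Let density_measure0 : density_measure mf f0 set0 = 0%E.
Proof. by rewrite /density_measure integral_set0. Qed.

Let density_measure_ge0 A : (0 <= density_measure mf f0 A)%E.
Proof. by apply: integral_ge0. Qed.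

Let density_measure_sigma_additive : semi_sigma_additive (density_measure mf f0).
Proof.
move=> F mF tF mUF; rewrite /density_measure ge0_integral_bigcup//; last first.
  exact: measurable_funTS.
by apply: is_cvg_ereal_nneg_natsum => n _; exact: integral_ge0.
Qed.

HB.instance Definition _ := isMeasure.Build _ _ _ (density_measure mf f0)
  density_measure0 density_measure_ge0 density_measure_sigma_additive.

End density_measure.

(** * Rays as a generating pi-system *)

Section rays.
Variable R : realType.
Local Notation Z := ((R * R) * R)%type.

(** Orthants open towards +oo: on the cube, their indicators are limits of products of bumps. *)
Definition ray (a : Z) : set Z :=
  (`]a.1.1, +oo[%classic `*` `]a.1.2, +oo[%classic) `*` `]a.2, +oo[%classic.

Lemma ray_setI_closed : setI_closed (range ray).
Proof.
move=> _ _ [a _ <-] [b _ <-].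
exists ((Num.max a.1.1 b.1.1, Num.max a.1.2 b.1.2), Num.max a.2 b.2) => //.
apply/seteqP; split => -[[x y] z]; rewrite /ray /= !in_itv/= !andbT !gt_max.
  by move=> [[/andP[? ?] /andP[? ?]] /andP[? ?]].
by move=> [[[? ?] ?] [[? ?] ?]]; split; [split|]; apply/andP.
Qed.

Lemma measurable_ray a : measurable (ray a).
Proof. by apply: measurableX; [apply: measurableX|]; exact: measurable_itv. Qed.

Lemma bigcup_ray : \bigcup_n ray ((- n%:R, - n%:R), - n%:R) = setT.
Proof.
apply/seteqP; split => // -[[x y] z] _.
pose M := Num.max (Num.max `|x| `|y|) `|z|.
exists (Num.truncn M).+1 => //; have := truncnS_gt M.
rewrite /M !gt_max => /andP[/andP[hx hy] hz].
by split; [split|]; rewrite /= in_itv/= andbT ltrNl (le_lt_trans (ler_norm _))// normrN.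
Qed.

Lemma measurable_rays_preimage (S : set (set Z)) (h : Z -> R) : sigma_algebra setT S ->
  (forall r, S (h @^-1` `]r, +oo[%classic)) ->
  forall B : set R, measurable B -> S (h @^-1` B).
Proof.
move=> sS hS B mB.
have sB : (@RGenOInfty.G R).-sigma.-measurable B by rewrite -RGenOInfty.measurableE.
apply: (sB [set B | S (h @^-1` B)]); split.
- split => /=.
  + by rewrite preimage_set0; case: sS.
  + by move=> A SA; rewrite setTD preimage_setC; case: sS => _ + _; rewrite -setTD; apply.
  + by move=> F SF; rewrite preimage_bigcup; case: sS => _ _; apply.
- by move=> _ [r ->]; exact: hS.
Qed.

(** A coordinate half-space is a countable union of rays whose other two corner coordinates run to
    -oo, so the three coordinate maps are measurable for the sigma-algebra generated by rays. *)
Lemma measurable_rays : @measurable _ Z = <<s range ray >>.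
Proof.
set S := <<s _ >>; have sS : sigma_algebra setT S by exact: smallest_sigma_algebra.
have SC A : S A -> S (~` A) by rewrite -setTD; case: sS => _ + _; exact.
apply/seteqP; split; last first.
  by apply: smallest_sub; [exact: sigma_algebra_measurable|move=> _ [a _ <-];
    exact: measurable_ray].
have Sray a : S (ray a) by apply: sub_gen_smallest; exists a.
have SU (F : nat -> set Z) : (forall n, S (F n)) -> S (\bigcup_n F n).
  by case: sS => _ _; exact.
have proj (h : Z -> R) : 
  (forall r, exists F : nat -> Z, h @^-1` `]r, +oo[%classic = \bigcup_n ray (F n)) ->
  forall B : set R, measurable B -> S (h @^-1` B).
  move=> hF; apply: measurable_rays_preimage => // r.
  by have [F ->] := hF r; apply: SU.
have big (x : R) : exists n : nat, - n%:R < x.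
  exists (Num.truncn `|x|).+1; rewrite ltrNl (le_lt_trans (ler_norm _))// normrN.
  exact: truncnS_gt.
have mono (x : R) (p q : nat) : (p <= q)%N -> - p%:R < x -> - q%:R < x.
  by move=> pq; apply: le_lt_trans; rewrite lerN2 ler_nat.
have S1 : forall B : set R, measurable B -> S ((fun z => z.1.1) @^-1` B).
  apply: proj => r; exists (fun n => ((r, - n%:R), - n%:R)).
  apply/seteqP; split => -[[x y] z] /=; rewrite ?in_itv/= ?andbT.
    move=> rx; have [[p yp] [q zq]] := (big y, big z).
    exists (maxn p q) => //; split; [split|]; rewrite /= in_itv/= andbT//.
      exact: mono (leq_maxl _ _) yp.
    exact: mono (leq_maxr _ _) zq.
  by move=> [n _ [[/=]]]; rewrite !in_itv/= andbT.
have S2 : forall B : set R, measurable B -> S ((fun z => z.1.2) @^-1` B).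
  apply: proj => r; exists (fun n => ((- n%:R, r), - n%:R)).
  apply/seteqP; split => -[[x y] z] /=; rewrite ?in_itv/= ?andbT.
    move=> rx; have [[p yp] [q zq]] := (big x, big z).
    exists (maxn p q) => //; split; [split|]; rewrite /= in_itv/= andbT//.
      exact: mono (leq_maxl _ _) yp.
    exact: mono (leq_maxr _ _) zq.
  by move=> [n _ [[/= _]]]; rewrite !in_itv/= andbT.
have S3 : forall B : set R, measurable B -> S (snd @^-1` B).
  apply: proj => r; exists (fun n => ((- n%:R, - n%:R), r)).
  apply/seteqP; split => -[[x y] z] /=; rewrite ?in_itv/= ?andbT.
    move=> rx; have [[p yp] [q zq]] := (big x, big y).
    exists (maxn p q) => //; split; [split|]; rewrite /= in_itv/= andbT//.
      exact: mono (leq_maxl _ _) yp.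
    exact: mono (leq_maxr _ _) zq.
  by move=> [n _ [_ /=]]; rewrite !in_itv/= andbT.
have S12 : forall B : set (R * R), measurable B -> S (fst @^-1` B).
  move=> B mB; apply: (mB [set B | S (fst @^-1` B)]); split.
    split => /=.
    - by rewrite preimage_set0; case: sS.
    - by move=> A SA; rewrite setTD preimage_setC; exact: SC.
    - by move=> F SF; rewrite preimage_bigcup; exact: SU.
  move=> A [|] [C mC <-]; rewrite setTI /=; [exact: S1|exact: S2].
move=> A mA; apply: mA; split => //.
by move=> B [|] [C mC <-]; rewrite setTI; [exact: S12|exact: S3].
Qed.
End rays.

(** * Functions determined by their integrals over rays *)

Section rays_determine.
Variable R : realType.
Local Notation Z := ((R * R) * R)%type.

(* The type carrying [leb3]; as a measurable type it differs from [Z] only by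
   its display. *)
Local Notation T3 :=
  ((measurableTypeR R * measurableTypeR R) * measurableTypeR R)%type.

(** The positive and negative parts of [h] are densities of two measures that agree on rays. They
    take finite values on an exhausting sequence of rays, hence coincide, and [h] integrates to 0
    over every measurable subset of [D]. *)
Lemma ray_integral0_ae (mu : {measure set T3 -> \bar R}) (D : set T3)
    (mD : measurable D) (h : T3 -> R) : mu.-integrable D (EFin \o h) ->
  (forall a : Z, (\int[mu]_(z in D `&` ray a) (h z)%:E = 0)%E) ->
  ae_eq mu D (EFin \o h) (cst 0%E).
Proof.
move=> ih h0.
pose hD : T3 -> \bar R := EFin \o (h \_ D).
have ihD : mu.-integrable setT hD by rewrite /hD -restrict_EFin -integrable_mkcond.
have mhD : measurable_fun setT hD by exact: measurable_int ihD.
have mp : measurable_fun setT hD^\+%E by exact: measurable_funepos.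
have mn : measurable_fun setT hD^\-%E by exact: measurable_funeneg.
have p0 z : (0 <= hD^\+ z)%E by exact: funepos_ge0.
have n0 z : (0 <= hD^\- z)%E by exact: funeneg_ge0.
have intE E : (\int[mu]_(z in E) hD z =
    \int[mu]_(z in E) hD^\+ z - \int[mu]_(z in E) hD^\- z)%E.
  by rewrite integralE.
have finp E : measurable E -> (\int[mu]_(z in E) hD^\+ z)%E \is a fin_num.
  move=> mE; apply: integrable_fin_num => //.
  by apply: (@integrableS _ _ _ _ setT) => //; exact: integrable_funepos.
have finn E : measurable E -> (\int[mu]_(z in E) hD^\- z)%E \is a fin_num.
  move=> mE; apply: integrable_fin_num => //.
  by apply: (@integrableS _ _ _ _ setT) => //; exact: integrable_funeneg.
have ray_eq A : range (@ray R) A ->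
    density_measure mu mp p0 A = density_measure mu mn n0 A.
  move=> [a _ <-]; have mr := @measurable_ray R a.
  have := intE (ray a).
  have -> : (\int[mu]_(z in ray a) hD z = 0)%E.
    transitivity (\int[mu]_(z in ray a `&` D) (h z)%:E)%E.
      rewrite [RHS]integral_mkcondr; apply: eq_integral => z _.
      by rewrite /hD /= !patchE; case: ifPn.
    by rewrite setIC h0.
  move/esym/eqP; rewrite sube_eq ?finp ?finn ?add0e//.
  by move/eqP.
have ray_fin n : (density_measure mu mp p0
    (ray ((- n%:R, - n%:R), - n%:R)%R) < +oo)%E.
  rewrite -ge0_fin_numE ?integral_ge0//.
  by apply: finp; exact: measurable_ray.
have ray_range n : range (@ray R) (ray ((- n%:R, - n%:R), - n%:R)) by eexists.
have eqE E : measurable E ->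
    density_measure mu mp p0 E = density_measure mu mn n0 E.
  move=> mE.
  pose m1 : {measure set T3 -> \bar R} := density_measure mu mp p0.
  pose m2 : {measure set T3 -> \bar R} := density_measure mu mn n0.
  exact (@measure_unique _ R T3 (range (@ray R)) _ (@measurable_rays R)
    (@ray_setI_closed R) ray_range (@bigcup_ray R) m1 m2 ray_eq ray_fin E mE).
apply: integral_ae_eq => //.
move=> E ED mE; rewrite [RHS]integral0.
have -> : (\int[mu]_(z in E) (EFin \o h) z = \int[mu]_(z in E) hD z)%E.
  apply: eq_integral => z; rewrite inE => Ez.
  by rewrite /hD /= patchE mem_set//; exact: ED.
rewrite intE; have := eqE E mE; rewrite /density_measure => ->.
by rewrite subee// finn.
Qed.

End rays_determine.

(** * Measure structures on the plane and in space-time *)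

Section leb_sigma_finite.
Variable R : realType.

HB.instance Definition _ := Measure.copy (@leb2 R) (@leb1 R \x @leb1 R)%E.
HB.instance Definition _ := Measure.copy (@leb3 R) (@leb2 R \x @leb1 R)%E.

Let sigma_finite_leb2 : sigma_finite setT (@leb2 R).
Proof.
pose I n : set R := `[- n%:R, n%:R]%classic.
have cI x : exists n, I n x.
  exists (Num.truncn `|x|).+1; rewrite /I/= in_itv/= -ler_norml ltW//.
  exact: truncnS_gt.
have leI p q : (p <= q)%N -> I p `<=` I q.
  move=> pq x; rewrite /I/= !in_itv/= -!ler_norml => /le_trans; apply.
  by rewrite ler_nat.
exists (fun n => I n `*` I n).
  rewrite predeqE => -[x y]; split => // _.
  have [[p px] [q qy]] := (cI x, cI y).
  exists (maxn p q) => //=; split; rewrite /=.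
    exact: leI (leq_maxl _ _) _ px.
  exact: leI (leq_maxr _ _) _ qy.
move=> n; split; first by apply: measurableX; exact: measurable_itv.
rewrite /leb2 product_measure1E /leb1; [|exact: measurable_itv..].
rewrite /I/= lebesgue_measure_itv/= lte_fin.
by case: ifPn => // _; rewrite ?mule0// -EFinM ltry.
Qed.

HB.instance Definition _ :=
  Measure_isSigmaFinite.Build _ _ _ (@leb2 R) sigma_finite_leb2.

End leb_sigma_finite.

(** * The Poincare inequality *)
Section poincare.
Variable R : realType.
Local Notation Z := ((R * R) * R)%type.
Local Notation leb := (@lebesgue_measure R).
Implicit Types (u g : Z -> R).

Lemma leb3_Dom : (@leb3 R (@Dom R) = 1)%E.
Proof.
have l01 : (@leb1 R `]0%R, 1%R[%classic = 1)%E.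
  by rewrite /leb1 lebesgue_measure_itv/= lte01 sube0.
have -> : (@leb3 R (@Dom R) = @leb2 R (@Omega R) * @leb1 R `]0%R, 1%R[%classic)%E.
  by rewrite /leb3 /Dom product_measure1E//; exact: measurableX.
rewrite l01 mule1.
transitivity (@leb1 R `]0%R, 1%R[%classic * @leb1 R `]0%R, 1%R[%classic)%E.
  exact: product_measure1E.
by rewrite l01 mule1.
Qed.

Lemma leb3_Dom_fin : (@leb3 R (@Dom R) < +oo)%E.
Proof. by rewrite leb3_Dom ltry. Qed.

Lemma measurable_restrict_Dom u : measurable_fun (@Dom R) u ->
  measurable_fun setT (u \_ (@Dom R)).
Proof.
move=> mu_; apply/(measurable_restrict _ _ measurableT).
  exact: (@measurable_Dom R).
by rewrite setTI.
Qed.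

Lemma restrict_Dom0 u z : ~ Dom z -> (u \_ (@Dom R)) z = 0.
Proof. by move=> nz; rewrite patchE memNset. Qed.

Lemma restrict_Dom_time0 u z : ~ (0 < z.2 < 1) -> (u \_ (@Dom R)) z = 0.
Proof. by move=> nz; apply: restrict_Dom0 => -[_ /=]; rewrite in_itv/=. Qed.

Lemma integrable_restrict_Dom u : (@leb3 R).-integrable (@Dom R) (EFin \o u) ->
  (@leb3 R).-integrable setT (EFin \o (u \_ (@Dom R))).
Proof.
move=> iu; rewrite -restrict_EFin -(@integrable_mkcond _ _ _ (@leb3 R) (@Dom R))//.
exact: (@measurable_Dom R).
Qed.

Lemma L2_integrable u : measurable_fun (@Dom R) u ->
  (\int[@leb3 R]_(z in @Dom R) (u z ^+ 2)%:E < +oo)%E ->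
  (@leb3 R).-integrable (@Dom R) (EFin \o u).
Proof.
move=> mu_ u2; apply: integrable_sqr_integrable => //; last exact: leb3_Dom_fin.
exact: (@measurable_Dom R).
Qed.

Lemma integral_restrict_sqr u : (\int[@leb3 R]_z ((u \_ (@Dom R)) z ^+ 2)%:E =
  \int[@leb3 R]_(z in @Dom R) (u z ^+ 2)%:E)%E.
Proof.
rewrite [RHS]integral_mkcond; apply: eq_integral => z _; rewrite !patchE.
by case: ifPn => // _; rewrite expr0n.
Qed.

Lemma continuous_Dom_measurable (q : Z -> R) :
  continuous q -> measurable_fun (@Dom R) q.
Proof.
by move=> cq; apply: continuous_closedCube_measurable; exact: continuous_subspaceT.
Qed.

Lemma integrable_mul_continuous (v q : Z -> R) :
  (@leb3 R).-integrable (@Dom R) (EFin \o v) -> continuous q ->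
  (@leb3 R).-integrable (@Dom R) (EFin \o (fun z => v z * q z)).
Proof.
move=> iv cq; have [K _ KP] := continuous_closedCube_bounded (continuous_subspaceT cq).
apply: (@integrable_mulr_bounded _ _ R (@leb3 R) (@Dom R) (@measurable_Dom R) v
  q (K : R) iv (continuous_Dom_measurable cq)).
by move=> z Dz; apply: KP; exact: Dom_subset_closedCube.
Qed.

(** Extending [g] by zero outside [Dom] supplies the upper limit t = 1. *)
Definition tail_integral g : Z -> R :=
  volterra (fun t s => t <= s) (g \_ (@Dom R)).

Lemma measurable_tail_integral g : measurable_fun (@Dom R) g ->
  measurable_fun setT (tail_integral g).
Proof.
move=> mg; apply: measurable_volterra; first exact: measurable_rel_le.
exact: measurable_restrict_Dom.
Qed.

Lemma tail_integral_sqr g : measurable_fun (@Dom R) g ->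
  (\int[@leb3 R]_(z in @Dom R) (tail_integral g z ^+ 2)%:E <=
   \int[@leb3 R]_(z in @Dom R) (g z ^+ 2)%:E)%E.
Proof.
move=> mg; rewrite -[leRHS]integral_restrict_sqr.
apply: (@volterra_sqr_integral _ _ _ (@leb2 R)).
- exact: measurableX.
- exact: measurable_rel_le.
- exact: measurable_restrict_Dom.
- by move=> z; exact: restrict_Dom_time0.
Qed.

Lemma tail_integral_out g z : ~ Omega z.1 -> tail_integral g z = 0.
Proof.
move=> nz; rewrite /tail_integral /volterra /cutint integral0_eq// => s _.
by rewrite /cutoff restrict_Dom0 ?if_same// => -[].
Qed.

(** For almost every fixed [x], [cutint_swap] moves the primitive from the bump onto [g];
    integrability of both products over the cube lets Fubini reduce to such fibres. *)
Lemma tail_integral_swap g (a1 a2 a3 : R) n : 0 <= a1 -> 0 <= a2 -> 0 <= a3 ->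
  measurable_fun (@Dom R) g ->
  (\int[@leb3 R]_(z in @Dom R) (g z ^+ 2)%:E < +oo)%E ->
  (\int[@leb3 R]_(z in @Dom R)
     (g z * uncurry3 (prod3 (bump a1 n) (bump a2 n) (bump_prim a3 n)) z)%:E =
   \int[@leb3 R]_(z in @Dom R)
     (tail_integral g z * uncurry3 (prod3 (bump a1 n) (bump a2 n) (bump a3 n)) z)%:E)%E.
Proof.
move=> a10 a20 a30 mg g2.
have ig := L2_integrable mg g2.
have mT := measurable_tail_integral mg.
have iT : (@leb3 R).-integrable (@Dom R) (EFin \o tail_integral g).
  apply: L2_integrable; first exact: measurable_funTS.
  exact: le_lt_trans (tail_integral_sqr mg) g2.
have cb a := @bump_continuous R a n.
have cB : continuous (bump_prim a3 n) := C1R_continuous (bump_prim_C1 n a30).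
have cP := prod3_continuous (cb a1) (cb a2) cB.
have cQ := prod3_continuous (cb a1) (cb a2) (cb a3).
have iP := integrable_restrict_Dom (integrable_mul_continuous ig cP).
have iQ := integrable_restrict_Dom (integrable_mul_continuous iT cQ).
rewrite integral_mkcond restrict_EFin [RHS]integral_mkcond restrict_EFin.
rewrite -[LHS](@integral12_prod_meas1 _ _ _ _ _ (@leb2 R) (@leb1 R) _ iP).
rewrite -[RHS](@integral12_prod_meas1 _ _ _ _ _ (@leb2 R) (@leb1 R) _ iQ).
apply: ae_eq_integral => //.
- exact: (measurable_int _ (integrable_fubini_F iP)).
- exact: (measurable_int _ (integrable_fubini_F iQ)).
have := ae_integrable1 (integrable_restrict_Dom ig).
apply: filterS => x /= igx _; rewrite /fubini_F /=.
set c := fun s => (g \_ (@Dom R)) (x, s).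
have igc : leb.-integrable setT (EFin \o c) by exact: igx.
have ib := bump_integrable n a30.
transitivity ((bump a1 n x.1 * bump a2 n x.2)%:E *
    \int[leb]_t (c t * bump_prim a3 n t)%:E)%E.
  rewrite -integralZl//; last first.
    apply: (@integrable_mulr_bounded _ _ R leb setT measurableT c (bump_prim a3 n)
      (fine (\int[leb]_s `|bump a3 n s|%:E)%E) igc).
      exact: continuous_measurable_fun.
    move=> t _; rewrite bump_primE; apply: cutint_norm_le => //.
    exact: (@measurable_rel_line R _ t (@measurable_rel_ge R)).
  apply: eq_integral => t _; rewrite -EFinM !patchE /c patchE.
  by case: ifPn => _; rewrite ?mul0r ?mulr0// /uncurry3 /prod3/=; congr EFin; ring.
under eq_integral do rewrite bump_primE.
rewrite cutint_swap//.
rewrite -integralZl//; last first.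
  apply: (@integrable_mulr_bounded _ _ R leb setT measurableT (bump a3 n)
    (fun s => tail_integral g (x, s)) (fine (\int[leb]_s `|c s|%:E)%E) ib).
    exact: measurable_section mT.
  move=> t _; apply: cutint_norm_le => //.
  exact: (@measurable_rel_line R _ t (@measurable_rel_le R)).
apply: eq_integral => s _; rewrite -EFinM !patchE.
case: ifPn => [_|].
  rewrite /uncurry3 /prod3 /= -[cutint _ c]/(tail_integral g (x, s)).
  by congr EFin; ring.
rewrite notin_setE => nD; congr EFin.
(* Outside the cube both sides must vanish: over a point of [Omega] through the time bump, elsewhere
   through the tail integral. *)
have [Ox|nOx] := pselect (Omega x).
  have -> : bump a3 n s = 0.
    apply/eqP/negP => /negP /bump_supp h; apply: nD; split => //=.
    have : 0 < n.+1%:R^-1 :> R by rewrite invr_gt0.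
    rewrite in_itv/=; move: (n.+1%:R^-1) h => e /andP[h1 h2] e0.
    by apply/andP; split; lra.
  by rewrite mul0r mulr0.
by rewrite -[cutint _ c]/(tail_integral g (x, s)) tail_integral_out// !mulr0.
Qed.

(** The bumps are bounded by 1 for nonnegative corners, which gives the majorant |h|. Replacing the
    coordinates of [a] by their positive parts does not change the part of the ray inside the
    cube. *)
Lemma ray_integral0 (h : Z -> R) : (@leb3 R).-integrable (@Dom R) (EFin \o h) ->
  (forall (a1 a2 a3 : R) n, 0 <= a1 -> 0 <= a2 -> 0 <= a3 ->
    (\int[@leb3 R]_(z in @Dom R)
      (h z * uncurry3 (prod3 (bump a1 n) (bump a2 n) (bump a3 n)) z)%:E = 0)%E) ->
  forall a : Z, (\int[@leb3 R]_(z in @Dom R `&` ray a) (h z)%:E = 0)%E.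
Proof.
move=> ih h0 a; have mh : measurable_fun (@Dom R) h.
  by apply/measurable_EFinP; exact: measurable_int ih.
pose a1 := Num.max 0 a.1.1; pose a2 := Num.max 0 a.1.2; pose a3 := Num.max 0 a.2.
have [a10 a20 a30] : [/\ 0 <= a1, 0 <= a2 & 0 <= a3].
  by rewrite /a1 /a2 /a3 !le_max !lexx.
pose f n (z : Z) := (h z * uncurry3 (prod3 (bump a1 n) (bump a2 n) (bump a3 n)) z)%:E.
have mf n : measurable_fun (@Dom R) (f n).
  apply: (@measurable_int _ _ _ (@leb3 R)).
  apply: integrable_mul_continuous ih _.
  by apply: prod3_continuous; exact: bump_continuous.
have mray : measurable (ray a) by exact: measurable_ray.
have [|||||_ _ cf] := @dominated_convergence _ _ R (@leb3 R) (@Dom R) (@measurable_Dom R)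
  f (EFin \o (h \_ (ray a))) (fun z => `|h z|%:E).
- exact: mf.
- apply/measurable_EFinP; apply/(measurable_restrict _ mray) => //.
    exact: (@measurable_Dom R).
  by apply: measurable_funS mh => //; exact: (@measurable_Dom R).
- apply: nearW => z Dz; apply: cvg_EFin; first exact: nearW.
  rewrite (_ : (h \_ (ray a)) z = h z * ((\1_(`]a1, 1[%classic) z.1.1 : R) *
      (\1_(`]a2, 1[%classic) z.1.2 : R) * (\1_(`]a3, 1[%classic) z.2 : R))).
    apply: cvgM; first exact: cvg_cst.
    by apply: cvgM; [apply: cvgM|]; exact: bump_cvg.
  move: Dz => [[/=]]; rewrite !in_itv/= => /andP[p1 q1] /andP[p2 q2] /andP[p3 q3].
  rewrite patchE !indicE.
  have mem01 (b c : R) : 0 < c -> c < 1 -> (c \in `]Num.max 0 b, 1[%classic) = (b < c).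
    by move=> c0 c1; apply/idP/idP; rewrite inE/= in_itv/= gt_max c0 c1 andbT.
  rewrite !mem01//.
  have -> : (z \in ray a) = [&& a.1.1 < z.1.1, a.1.2 < z.1.2 & a.2 < z.2].
    apply/idP/idP; rewrite inE /ray /= !in_itv/= !andbT.
      by move=> [[-> ->] ->].
    by move=> /and3P[-> -> ->].
  by case: (_ < _); case: (_ < _); case: (_ < _); rewrite ?mulr1 ?mulr0 ?mul0r ?mulr0.
- have := integrable_abse ih; apply: eq_integrable => //.
  exact: (@measurable_Dom R).
- apply: nearW => z n _; rewrite /f /= lee_fin normrM ler_piMr//.
  rewrite /uncurry3 /prod3 !normrM.
  have b1 c s : 0 <= c -> `|bump c n s| <= 1.
    by move=> c0; have /andP[? ?] := bump_itv n s c0; rewrite ger0_norm.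
  by rewrite -[leRHS]mulr1 ler_pM ?mulr_ge0 ?b1// -[leRHS]mulr1 ler_pM ?b1.
rewrite integral_mkcondr restrict_EFin.
have : (fun n => \int[@leb3 R]_(z in @Dom R) f n z)%E = cst 0%E.
  by apply/funext => n; rewrite /f h0.
move=> fE; move: cf; rewrite fE => cf.
have := cvg_unique _ cf (cvg_cst _ : cst 0%E @ \oo --> 0%E).
by move=> ->.
Qed.

Lemma du_bois_reymond (h : Z -> R) : (@leb3 R).-integrable (@Dom R) (EFin \o h) ->
  (forall a : Z, (\int[@leb3 R]_(z in @Dom R `&` ray a) (h z)%:E = 0)%E) ->
  ae_eq (@leb3 R) (@Dom R) (EFin \o h) (cst 0%E).
Proof.
pose mu : {measure set _ -> \bar R} := @leb3 R.
exact (@ray_integral0_ae R mu (@Dom R) (@measurable_Dom R) h).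
Qed.

Lemma poincare u g : measurable_fun (@Dom R) u -> measurable_fun (@Dom R) g ->
  (\int[@leb3 R]_(z in @Dom R) (u z ^+ 2)%:E < +oo)%E ->
  (\int[@leb3 R]_(z in @Dom R) (g z ^+ 2)%:E < +oo)%E ->
  (forall p, test_fun_top p ->
    (\int[@leb3 R]_(z in @Dom R) (u z * uncurry3 (partial p ord_max) z)%:E =
     - \int[@leb3 R]_(z in @Dom R) (g z * uncurry3 p z)%:E)%E) ->
  (\int[@leb3 R]_(z in @Dom R) (u z ^+ 2)%:E <=
   \int[@leb3 R]_(z in @Dom R) (g z ^+ 2)%:E)%E.
Proof.
move=> mu_ mg u2 g2 ug; have mD := @measurable_Dom R.
pose v := tail_integral g.
have mv : measurable_fun (@Dom R) v by apply: measurable_funTS; exact: measurable_tail_integral.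
have v2 : (\int[@leb3 R]_(z in @Dom R) (v z ^+ 2)%:E < +oo)%E.
  exact: le_lt_trans (tail_integral_sqr mg) g2.
have iu := L2_integrable mu_ u2; have iv := L2_integrable mv v2.
pose h z := u z + v z.
have ih : (@leb3 R).-integrable (@Dom R) (EFin \o h).
  rewrite (_ : EFin \o h = (fun z => (u z)%:E + (v z)%:E)%E)//.
  exact: integrableD.
have hr := ray_integral0 ih.
have /(du_bois_reymond ih) : forall a : Z,
    (\int[@leb3 R]_(z in @Dom R `&` ray a) (h z)%:E = 0)%E.
  apply: hr => a1 a2 a3 n a10 a20 a30.
  have cq := prod3_continuous (@bump_continuous R a1 n) (@bump_continuous R a2 n)
    (@bump_continuous R a3 n).
  have := ug _ (bump_test_fun_top n a10 a20 a30).
  (* Writing b for the product of bumps and B for the test function, Green's formula equates the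
     integral of u b with minus that of g B, and the swap turns the latter into minus that of v
     b. *)
  rewrite bump_test_partial// tail_integral_swap// -/v => uv.
  under eq_integral do rewrite /h mulrDl EFinD.
  rewrite integralD//=; [|exact: (integrable_mul_continuous _ cq)..].
  rewrite uv addeC subee//.
  by apply: integrable_fin_num => //; exact: (integrable_mul_continuous _ cq).
move=> h0; apply: le_trans (tail_integral_sqr mg).
rewrite le_eqVlt; apply/orP; left; apply/eqP.
apply: ge0_ae_eq_integral => //.
- by apply/measurable_EFinP; exact: measurable_funX.
- by apply/measurable_EFinP; exact: measurable_funX.
- by move=> z _; rewrite lee_fin sqr_ge0.
- by move=> z _; rewrite lee_fin sqr_ge0.
- apply: filterS h0 => z h0 Dz; have := h0 Dz; rewrite /h /= => -[uv0].
  by rewrite (_ : u z = - v z) ?sqrrN//; apply/eqP; rewrite -addr_eq0 uv0.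
Qed.

End poincare.

(** * Linearity and limits of Volterra integrals *)

Section volterra_ae.
Context dX (X : measurableType dX) (R : realType).
Variable m : {sigma_finite_measure set X -> \bar R}.
Local Notation leb := (@lebesgue_measure R).
Implicit Types (k : R -> R -> bool) (u v : X * R -> R).

Lemma volterra_lin k u v (a b : R) : measurable_rel k ->
  (m \x leb)%E.-integrable setT (EFin \o u) ->
  (m \x leb)%E.-integrable setT (EFin \o v) ->
  {ae (m \x leb)%E, forall z, volterra k (fun z => a * u z + b * v z) z =
    a * volterra k u z + b * volterra k v z}.
Proof.
move=> mk iu iv.
have ? : Filter (nbhs (almost_everywhere (m \x leb)%E)) := ae_filter_ringOfSetsType _.
have := ae_integrable_section iv; have := ae_integrable_section iu.
apply: filterS2 => z iuz ivz; rewrite /volterra.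
exact: (cutintD a b (measurable_rel_line z.2 mk) iuz ivz).
Qed.

(** [ae_section] passes to almost every fibre, where dominated convergence applies for every [t] at
    once; [ae_fst] then returns to the product. *)
Lemma volterra_cvg k (u : nat -> X * R -> R) v (M : X * R -> R) :
  measurable_rel k -> (forall n, measurable_fun setT (u n)) -> measurable_fun setT v ->
  (m \x leb)%E.-integrable setT (EFin \o M) ->
  {ae (m \x leb)%E, forall z, u ^~ z @ \oo --> v z} ->
  {ae (m \x leb)%E, forall z n, `|u n z| <= M z} ->
  {ae (m \x leb)%E, forall z, volterra k (u n) z @[n --> \oo] --> volterra k v z}.
Proof.
move=> mk mu_ mv iM uv uM.
have ? : Filter (nbhs (almost_everywhere (m \x leb)%E)) := ae_filter_ringOfSetsType _.
have h1 := ae_fst leb (ae_section uv); have h2 := ae_fst leb (ae_section uM).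
have := ae_integrable_section iM; move: h1 h2; apply: filterS3 => z h1 h2 iMz.
apply: (cutint_cvg _ _ _ iMz h1 h2).
- exact: measurable_rel_line.
- by move=> n; exact: measurable_section.
- exact: measurable_section.
Qed.

End volterra_ae.

(** * The direct method for strongly convex functionals *)
Section square_integrable.
Context d (T : measurableType d) (R : realType).
Variables (mu : {measure set T -> \bar R}) (D : set T) (mD : measurable D).
Hypothesis Dfin : (mu D < +oo)%E.
Implicit Types (u v g h : T -> R).

Definition sqint u : \bar R := (\int[mu]_(x in D) (u x ^+ 2)%:E)%E.

Definition L2D u := measurable_fun D u /\ (sqint u < +oo)%E.

Definition bounded_on (q : T -> R) := measurable_fun D q /\
  exists K : R, forall x, D x -> `|q x| <= K.

Lemma measurable_sqr u : measurable_fun D u ->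
  measurable_fun D (fun x => (u x ^+ 2)%:E).
Proof. by move=> mu_; apply/measurable_EFinP; exact: measurable_funX. Qed.

Lemma sqint_ge0 u : (0 <= sqint u)%E.
Proof. by apply: integral_ge0 => x _; rewrite lee_fin sqr_ge0. Qed.

Lemma sqint_lin u v (a b : R) : measurable_fun D u -> measurable_fun D v ->
  (sqint (fun x => a * u x + b * v x)%R <=
   (2 * a ^+ 2)%:E * sqint u + (2 * b ^+ 2)%:E * sqint v)%E.
Proof.
move=> mu_ mv.
have a0 : 0 <= 2 * a ^+ 2 by rewrite mulr_ge0// sqr_ge0.
have b0 : 0 <= 2 * b ^+ 2 by rewrite mulr_ge0// sqr_ge0.
have s0 (w : T -> R) x : D x -> (0 <= (w x ^+ 2)%:E)%E.
  by move=> _; rewrite lee_fin sqr_ge0.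
have mu2 := measurable_sqr mu_; have mv2 := measurable_sqr mv.
rewrite /sqint -(ge0_integralZl_EFin mu mD (s0 u) mu2 a0).
rewrite -(ge0_integralZl_EFin mu mD (s0 v) mv2 b0).
rewrite -ge0_integralD//; last 4 first.
- by move=> x _; rewrite -EFinM lee_fin mulr_ge0// sqr_ge0.
- exact: measurable_funeM.
- by move=> x _; rewrite -EFinM lee_fin mulr_ge0// sqr_ge0.
- exact: measurable_funeM.
apply: ge0_le_integral => //.
- by move=> x _; rewrite lee_fin sqr_ge0.
- by apply: measurable_sqr; apply: measurable_funD; exact: measurable_funM.
- by apply: emeasurable_funD; exact: measurable_funeM.
- move=> x _; rewrite -!EFinM -EFinD lee_fin.
  by have := sqr_ge0 (a * u x - b * v x); rewrite sqrrB sqrrD !exprMn; lra.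
Qed.

Lemma L2D_lin u v (a b : R) : L2D u -> L2D v -> L2D (fun x => a * u x + b * v x).
Proof.
move=> [mu_ u2] [mv v2]; split.
  by apply: measurable_funD; exact: measurable_funM.
apply: le_lt_trans (sqint_lin a b mu_ mv) _; apply: lte_add_pinfty.
- by rewrite lte_mul_pinfty// lee_fin mulr_ge0// sqr_ge0.
- by rewrite lte_mul_pinfty// lee_fin mulr_ge0// sqr_ge0.
Qed.

Lemma L2D_int u : L2D u -> mu.-integrable D (EFin \o u).
Proof. by move=> [mu_ u2]; exact: integrable_sqr_integrable. Qed.

Lemma integrable_mul_bounded_on u q : L2D u -> bounded_on q ->
  mu.-integrable D (EFin \o (fun x => u x * q x)).
Proof.
by move=> /L2D_int iu [mq [K qK]]; exact: (integrable_mulr_bounded mD iu mq qK).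
Qed.

(** [q] stands for a derivative of the test function [p]. Keeping the pair abstract treats the weak
    gradient and the trace condition alike. *)
Definition green (q p : T -> R) u g : Prop :=
  (\int[mu]_(x in D) (u x * q x)%:E = - \int[mu]_(x in D) (g x * p x)%:E)%E.

Lemma integral_mul_lin u v q (a b : R) : L2D u -> L2D v -> bounded_on q ->
  (\int[mu]_(x in D) ((a * u x + b * v x) * q x)%:E =
   a%:E * \int[mu]_(x in D) (u x * q x)%:E +
   b%:E * \int[mu]_(x in D) (v x * q x)%:E)%E.
Proof.
move=> Lu Lv bq; have iuq := integrable_mul_bounded_on Lu bq.
have ivq := integrable_mul_bounded_on Lv bq.
rewrite -(integralZl mD iuq) -(integralZl mD ivq).
rewrite -integralD//; [|exact: integrableZl..].
apply: eq_integral => x _; rewrite /= -!EFinM -EFinD; congr EFin; ring.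
Qed.

Lemma green_lin q p u v g h (a b : R) : bounded_on q -> bounded_on p ->
  L2D u -> L2D v -> L2D g -> L2D h -> green q p u g -> green q p v h ->
  green q p (fun x => a * u x + b * v x) (fun x => a * g x + b * h x).
Proof.
move=> cq cp Lu Lv Lg Lh ug vh; rewrite /green !integral_mul_lin// ug vh.
have fin w r : L2D w -> bounded_on r ->
    (\int[mu]_(x in D) (w x * r x)%:E)%E \is a fin_num.
  move=> Lw br; apply: integrable_fin_num => //.
  exact: integrable_mul_bounded_on Lw br.
by rewrite !muleN fin_num_oppeD// fin_numM// fin.
Qed.

(** The majorant bounds squares: this gives the L2 bound on the limit directly and, on a set of
    finite measure, dominates [u n] itself through |x| <= 1 + x^2. *)
Definition dominated_ae (u : nat -> T -> R) v (M : T -> R) : Prop :=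
  [/\ measurable_fun D v, mu.-integrable D (EFin \o M),
    {ae mu, forall x, D x -> u ^~ x @ \oo --> v x},
    {ae mu, forall x, D x -> forall n, u n x ^+ 2 <= M x} &
    {ae mu, forall x, D x -> v x ^+ 2 <= M x}].

Lemma normr_le_sqr1 (x : R) : `|x| <= 1 + x ^+ 2.
Proof.
rewrite -real_normK ?num_real//; have := sqr_ge0 (`|x| - 1).
by rewrite sqrrB1; have := normr_ge0 x; lra.
Qed.

Lemma integrable_onem_add (M : T -> R) : mu.-integrable D (EFin \o M) ->
  mu.-integrable D (EFin \o (fun x => 1 + M x)).
Proof.
move=> iM; rewrite (_ : EFin \o _ = (fun x => 1%:E + (M x)%:E)%E)//.
apply: integrableD => //; apply/integrableP; split; first exact: measurable_cst.
under eq_integral do rewrite gee0_abs ?lee_fin//.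
by rewrite integral_cst// mul1e.
Qed.

Lemma integral_mul_cvg (u : nat -> T -> R) v (M q : T -> R) : bounded_on q ->
  (forall n, measurable_fun D (u n)) -> dominated_ae u v M ->
  (\int[mu]_(x in D) (u n x * q x)%:E)%E @[n --> \oo] -->
  (\int[mu]_(x in D) (v x * q x)%:E)%E.
Proof.
move=> [mq [K KP]] mu_ [mv iM uv uM _].
have iM1 := integrable_onem_add iM.
have [|||||_ _ //] := @dominated_convergence _ _ R mu D mD
  (fun n x => (u n x * q x)%:E) (fun x => (v x * q x)%:E)
  (fun x => (K%:E * (1 + M x)%:E)%E).
- by move=> n; apply/measurable_EFinP; exact: measurable_funM.
- by apply/measurable_EFinP; exact: measurable_funM.
- apply: filterS uv => x uvx Dx; apply: cvg_EFin; first exact: nearW.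
  by apply: cvgM; [exact: uvx|exact: cvg_cst].
- exact: integrableZl.
- apply: filterS uM => x uMx n Dx; rewrite -EFinM lee_fin normrM mulrC.
  apply: ler_pM => //; first exact: KP.
  by apply: le_trans (normr_le_sqr1 _) _; rewrite lerD2l uMx.
Qed.

Lemma green_cvg (q p : T -> R) (u g : nat -> T -> R) v h (M N : T -> R) :
  bounded_on q -> bounded_on p ->
  (forall n, measurable_fun D (u n)) -> (forall n, measurable_fun D (g n)) ->
  dominated_ae u v M -> dominated_ae g h N ->
  (forall n, green q p (u n) (g n)) -> green q p v h.
Proof.
move=> bq bp mu_ mg uv gh ug.
have cu := integral_mul_cvg bq mu_ uv; have cg := integral_mul_cvg bp mg gh.
have cgN : (\int[mu]_(x in D) (u n x * q x)%:E)%E @[n --> \oo] -->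
    (- \int[mu]_(x in D) (h x * p x)%:E)%E.
  by under eq_fun do rewrite ug; exact: cvgeN.
exact: cvg_unique cu cgN.
Qed.

Lemma dominated_ae_L2D (u : nat -> T -> R) v M : dominated_ae u v M -> L2D v.
Proof.
move=> [mv iM _ _ vM]; split => //.
have /integrableP[mM Moo] := iM; apply: le_lt_trans Moo.
apply: ae_ge0_le_integral => //.
- by move=> x _; rewrite lee_fin sqr_ge0.
- exact: measurable_sqr.
- exact: measurableT_comp.
- apply: filterS vM => x vMx Dx; rewrite /= lee_fin.
  exact: le_trans (vMx Dx) (ler_norm _).
Qed.

(* Midpoint strong convexity makes a fast minimising sequence converge fast in
   L2, hence almost everywhere with a common majorant, so no weak compactness
   is needed. *)
Lemma strongly_convex_minimizer (I : Type) (adm : (I -> T -> R) -> Prop)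
    (F : (I -> T -> R) -> \bar R) (c : R) (U0 : I -> T -> R) :
  0 < c -> adm U0 ->
  (forall U, adm U -> (0 <= F U)%E) ->
  (forall U i, adm U -> L2D (U i)) ->
  (forall U V, adm U -> adm V -> exists2 W, adm W & forall i,
    (F W + c%:E * sqint (fun x => V i x - U i x)%R <=
     (2^-1)%:E * F U + (2^-1)%:E * F V)%E) ->
  (forall (U : nat -> I -> T -> R) (V M : I -> T -> R),
    (forall n, adm (U n)) -> (forall i, dominated_ae (U ^~ i) (V i) (M i)) ->
    adm V /\ forall (b : (\bar R)^nat) l,
      (forall n, F (U n) <= b n)%E -> b @ \oo --> l -> (F V <= l)%E) ->
  exists2 U, adm U & forall V, adm V -> (F U <= F V)%E.
Proof.
move=> c0 adm0 F0 admL2 convF closedF.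
pose m := ereal_inf [set F U | U in adm].
have mle U : adm U -> (m <= F U)%E by move=> aU; apply: ereal_inf_lbound; exists U.
have m0 : (0 <= m)%E by apply: le_ereal_inf_tmp => _ [U aU <-]; exact: F0.
(* The infimum may be +oo as far as the hypotheses tell; every admissible state is then a
   minimizer. *)
have [moo|moo] := eqVneq m +oo%E.
  by exists U0 => // V aV; rewrite (le_trans _ (mle V aV))// moo leey.
have mfin : m \is a fin_num by rewrite ge0_fin_numE// ltey.
pose r := fine m; have mE : m = r%:E by rewrite fineK.
have e0 n : 0 < 16^-1 ^+ n :> R by rewrite exprn_gt0.
have /choice[U UP] : forall n, exists U, adm U /\ (F U <= (r + 16^-1 ^+ n)%:E)%E.
  move=> n; have [_ [U aU <-] FU] := lb_ereal_inf_adherent (e0 n) mfin.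
  by exists U; split => //; rewrite EFinD -mE ltW.
have aU n : adm (U n) by have [] := UP n.
(* [W] has energy at least [r], while the energies of the two neighbours average at most r + 16^-n;
   the gap controls c times the squared distance. *)
have dU n i : (sqint (fun x => U n.+1 i x - U n i x)%R <=
    (c^-1 * 16^-1 ^+ n)%:E)%E.
  have [W aW /(_ i)] := convF _ _ (aU n) (aU n.+1).
  set s := sqint _ => FW.
  have : (r%:E + c%:E * s <= (r + 16^-1 ^+ n)%:E)%E.
    apply: le_trans (_ : F W + c%:E * s <= _)%E.
      by apply: leeD => //; rewrite -mE mle.
    apply: le_trans FW _.
    apply: le_trans (_ : (2^-1)%:E * (r + 16^-1 ^+ n)%:E +
        (2^-1)%:E * (r + 16^-1 ^+ n)%:E <= _)%E.
      apply: leeD; rewrite lee_pmul2l ?lte_fin//; first by have [] := UP n.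
      have [_ /le_trans] := UP n.+1; apply; rewrite lee_fin lerD2l.
      by rewrite exprS ler_piMl ?ltW//; lra.
    by rewrite -!EFinM -EFinD lee_fin; lra.
  have s0 : (0 <= s)%E by exact: sqint_ge0.
  case: s s0 {FW} => [s s0| |//]; last by rewrite gt0_muley ?lte_fin// addey// leye_eq.
  rewrite -EFinM -EFinD !lee_fin lerD2l => h.
  by rewrite mulrC ler_pdivlMr// mulrC.
have lim i : exists vM : (T -> R) * (T -> R), dominated_ae (U ^~ i) vM.1 vM.2.
  have [_ u0] := admL2 _ i (aU 0%N).
  have mU n : measurable_fun D (U n i) by have [] := admL2 _ i (aU n).
  have [v [M vM]] := fast_cauchy_L2 mD mU u0 (dU ^~ i).
  by exists (v, M).
have [V VP] := choice lim.
have [aV FV] := closedF U (fun i => (V i).1) (fun i => (V i).2) aU VP.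
exists (fun i => (V i).1) => // W aW; apply: le_trans (mle W aW); rewrite mE.
apply: (FV (fun n => (r + 16^-1 ^+ n)%:E)); first by move=> n; have [] := UP n.
apply: cvg_EFin; first exact: nearW.
rewrite -[X in _ --> X]addr0; apply: cvgD; first exact: cvg_cst.
by apply: cvg_expr; rewrite ger0_norm; lra.
Qed.

End square_integrable.

(** * The time integral in the temporal term *)

Section time_integral.
Variable R : realType.

(** The extension by zero vanishes at s = 0 whereas [u] may not, so the left endpoint is dropped
    first. The identity holds at every point of [Dom], with no exceptional set. *)
Lemma time_integralE (u : stfun R) z : measurable_fun (@Dom R) (uncurry3 u) -> Dom z ->
  fine (\int[@leb1 R]_(s in `[0%R, z.2]) (u z.1 s)%:E)%E =
  volterra (fun t s => s <= t) (uncurry3 u \_ (@Dom R)) z.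
Proof.
move=> mu_ Dz; have [Oz] := Dz; rewrite /= in_itv/= => /andP[z0 z1].
have mr := measurable_section z.1 (measurable_restrict_Dom mu_).
have uE s : s \in `]0, z.2]%classic -> (uncurry3 u \_ (@Dom R)) (z.1, s) = u z.1 s.
  rewrite inE/= in_itv/= => /andP[s0 sz]; rewrite patchE mem_set//.
  by split => //=; rewrite in_itv/= s0 (le_lt_trans sz).
rewrite /volterra /cutint /leb1; congr fine.
rewrite -integral_itv_obnd_cbnd; last first.
  apply/measurable_EFinP.
  apply: (eq_measurable_fun (fun s => (uncurry3 u \_ (@Dom R)) (z.1, s))) => //.
  exact: measurable_funTS.
rewrite integral_mkcond; apply: eq_integral => s _; rewrite patchE /cutoff.
case: ifPn => [sz|].
  by rewrite uE//; move: sz; rewrite inE/= in_itv/= => /andP[_ ->].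
rewrite notin_setE/= in_itv/= => h; case: ifPn => // sz.
rewrite restrict_Dom_time0//= => /andP[s0 _]; apply: h.
by rewrite s0.
Qed.

End time_integral.

(** * The energy density *)
Section energy_density.
Variables (R : realType) (f : stfun R) (eps epsnu lam a1 a2 : R).
Hypotheses (fC1 : C1_closed f) (eps0 : 0 < eps) (epsnu01 : 0 < epsnu < 1).
Hypotheses (lam0 : 0 < lam) (a10 : 0 < a1) (a20 : 0 < a2).
Local Notation Z := ((R * R) * R)%type.

(* Components of a state: [u1 j], then the derivative [G1 j i], then [u2 j]. *)
Definition comp := ('I_2 + 'I_2 * 'I_3 + 'I_2)%type.
Definition iu1 (j : 'I_2) : comp := inl (inl j).
Definition iG (j : 'I_2) (i : 'I_3) : comp := inl (inr (j, i)).
Definition iu2 (j : 'I_2) : comp := inr j.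
Implicit Types U V : comp -> Z -> R.

Definition grad_at (j : 'I_2) (z : Z) : R := gradf f z.1 z.2 j 0.
Definition sqgrad (z : Z) : R := sqnorm2 (gradf f z.1 z.2).
Definition phi_at (j : 'I_2) (z : Z) : R :=
  phi_coef eps (ft f z.1 z.2) (sqgrad z) * grad_at j z.

Definition residual U (j : 'I_2) (z : Z) : R :=
  U (iu1 j) z + U (iu2 j) z - phi_at j z.

Definition data_density U (z : Z) : R :=
  aniso eps (sqgrad z) *
    (grad_at 0 z * residual U 0 z + grad_at 1 z * residual U 1 z) ^+ 2 +
  Num.sqrt eps * (residual U 0 z ^+ 2 + residual U 1 z ^+ 2).

Definition smooth_density U (z : Z) : R :=
  nu epsnu lam (\sum_(j < 2) \sum_(i < 3) U (iG j i) z ^+ 2).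

Definition history U (j : 'I_2) : Z -> R :=
  volterra (fun t s => s <= t) (U (iu2 j) \_ (@Dom R)).

Definition temporal_density U (z : Z) : R := \sum_(j < 2) history U j z ^+ 2.

Definition density U (z : Z) : R :=
  data_density U z + a1 * smooth_density U z + a2 * temporal_density U z.

Lemma nu_ge0 r : 0 <= r -> 0 <= nu epsnu lam r.
Proof.
move=> r0; have /andP[n0 n1] := epsnu01; rewrite /nu addr_ge0//.
  by rewrite mulr_ge0// ltW.
rewrite mulr_ge0//; first by rewrite mulr_ge0 ?sqr_ge0// subr_ge0 ltW.
by rewrite subr_ge0 -[leLHS]sqrtr1 ler_wsqrtr// lerDl divr_ge0// sqr_ge0.
Qed.

Lemma smooth_density_ge0 U z : 0 <= smooth_density U z.
Proof.
by apply: nu_ge0; apply: sumr_ge0 => j _; apply: sumr_ge0 => i _; exact: sqr_ge0.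
Qed.

Lemma temporal_density_ge0 U z : 0 <= temporal_density U z.
Proof. by apply: sumr_ge0 => j _; exact: sqr_ge0. Qed.

Lemma data_density_ge0 U z : 0 <= data_density U z.
Proof.
rewrite addr_ge0// mulr_ge0 ?sqr_ge0 ?addr_ge0 ?sqr_ge0 ?sqrtr_ge0//.
by apply: aniso_ge0; exact: sqnorm2_ge0.
Qed.

Lemma density_ge0 U z : 0 <= density U z.
Proof.
apply: addr_ge0; [apply: addr_ge0; first exact: data_density_ge0|];
  apply: mulr_ge0; rewrite ?smooth_density_ge0 ?temporal_density_ge0//; exact: ltW.
Qed.

Definition all_measurable U := forall i, measurable_fun (@Dom R) (U i).

Lemma measurable_partial i :
  measurable_fun (@Dom R) (fun z => partial f i z.1 z.2).
Proof.
have [_ [g [cg fg]]] := fC1.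
apply: (eq_measurable_fun (uncurry3 (g i))); last exact: continuous_closedCube_measurable.
by move=> [x t]; rewrite inE => Dz; have [_ ->] := fg i x t Dz.
Qed.

Lemma measurable_grad_at j : measurable_fun (@Dom R) (grad_at j).
Proof.
rewrite (_ : grad_at j = (fun z => partial f (widen_ord (isT : (2 <= 3)%N) j) z.1 z.2)).
  exact: measurable_partial.
by apply/funext => z; rewrite /grad_at mxE.
Qed.

Lemma measurable_sqgrad : measurable_fun (@Dom R) sqgrad.
Proof.
by apply: measurable_funD; apply: measurable_funX; exact: measurable_grad_at.
Qed.

Lemma sqgrad_ge0 z : 0 <= sqgrad z. Proof. exact: sqnorm2_ge0. Qed.

Lemma measurable_sqrt_coef (k n : Z -> R) c : measurable_fun (@Dom R) k ->
  measurable_fun (@Dom R) n ->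
  measurable_fun (@Dom R) (fun z => sqrt_coef (k z) c (n z)).
Proof.
move=> mk mn; apply: measurable_funM => //; apply: measurable_fun_inv_ge0.
  apply: measurable_funD; first exact: measurable_cst.
  apply: measurable_fun_sqrt; apply: measurable_funD; first exact: measurable_cst.
  exact: measurable_funM.
by move=> z _; rewrite addr_ge0 ?sqrtr_ge0.
Qed.

Lemma measurable_aniso : measurable_fun (@Dom R) (fun z => aniso eps (sqgrad z)).
Proof. by apply: measurable_sqrt_coef; exact: measurable_sqgrad. Qed.

Lemma measurable_phi_at j : measurable_fun (@Dom R) (phi_at j).
Proof.
apply: measurable_funM; last exact: measurable_grad_at.
have mS : measurable_fun (@Dom R)
    (fun z => sqrt_coef (aniso eps (sqgrad z)) (Num.sqrt eps) (sqgrad z)).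
  by apply: measurable_sqrt_coef; [exact: measurable_aniso|exact: measurable_sqgrad].
apply: measurable_funM.
  apply: measurable_funM.
    by apply: measurableT_comp => //; exact: measurable_partial.
  apply: measurable_fun_inv_ge0; last by move=> z _; rewrite sqrtr_ge0.
  by apply: measurable_fun_sqrt; exact: measurable_sqgrad.
apply: measurable_fun_inv_ge0.
  apply: measurable_funD; last exact: measurable_cst.
  by apply: measurable_funM => //; exact: measurable_sqgrad.
move=> z _; rewrite addr_ge0 ?sqrtr_ge0// mulr_ge0 ?sqgrad_ge0//.
by rewrite divr_ge0 ?aniso_ge0 ?sqgrad_ge0// addr_ge0 ?sqrtr_ge0.
Qed.

Lemma measurable_residual U j : all_measurable U ->
  measurable_fun (@Dom R) (residual U j).
Proof.
by move=> mU; apply: measurable_funB; [exact: measurable_funD|exact: measurable_phi_at].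
Qed.

Lemma measurable_data_density U : all_measurable U ->
  measurable_fun (@Dom R) (data_density U).
Proof.
move=> mU; have mr j := measurable_residual j mU.
apply: measurable_funD; apply: measurable_funM.
- exact: measurable_aniso.
- apply: measurable_funX; apply: measurable_funD; apply: measurable_funM => //;
    exact: measurable_grad_at.
- exact: measurable_cst.
- by apply: measurable_funD; exact: measurable_funX.
Qed.

Lemma measurable_smooth_density U : all_measurable U ->
  measurable_fun (@Dom R) (smooth_density U).
Proof.
move=> mU.
have mS : measurable_fun (@Dom R)
    (fun z => \sum_(j < 2) \sum_(i < 3) U (iG j i) z ^+ 2).
  by apply: measurable_sum => j; apply: measurable_sum => i; exact: measurable_funX.
apply: measurable_funD; first exact: measurable_funM.
apply: measurable_funM; first exact: measurable_cst.
apply: measurable_funB; last exact: measurable_cst.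
apply: measurable_fun_sqrt; apply: measurable_funD; first exact: measurable_cst.
by apply: measurable_funM.
Qed.

Lemma measurable_history U j : all_measurable U ->
  measurable_fun setT (history U j).
Proof.
move=> mU; apply: measurable_volterra; first exact: measurable_rel_ge.
exact: measurable_restrict_Dom.
Qed.

Lemma measurable_temporal_density U : all_measurable U ->
  measurable_fun (@Dom R) (temporal_density U).
Proof.
move=> mU; apply: measurable_sum => j; apply: measurable_funX.
by apply: measurable_funTS; exact: measurable_history.
Qed.

Lemma measurable_density U : all_measurable U ->
  measurable_fun (@Dom R) (density U).
Proof.
move=> mU; apply: measurable_funD; last first.
  by apply: measurable_funM => //; exact: measurable_temporal_density.
apply: measurable_funD; first exact: measurable_data_density.
by apply: measurable_funM => //; exact: measurable_smooth_density.
Qed.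

Definition curry3 (w : Z -> R) : stfun R := fun x t => w (x, t).

Lemma curry3K w : uncurry3 (curry3 w) = w.
Proof. by apply/funext => -[x t]. Qed.

Definition energy U : \bar R := Fs f eps epsnu lam a1 a2
  (fun j => curry3 (U (iu1 j))) (fun j i => curry3 (U (iG j i)))
  (fun j => curry3 (U (iu2 j))).

(** The data term integrates over space inside and time outside; nonnegativity of the density lets
    Tonelli merge the two without any finiteness. *)
Lemma data_termE U : all_measurable U ->
  data_term f eps (fun j => curry3 (U (iu1 j))) (fun j => curry3 (U (iu2 j))) =
  (\int[@leb3 R]_(z in @Dom R) (data_density U z)%:E)%E.
Proof.
move=> mU; have md := measurable_data_density mU.
have dE x t : (let w := vec_at (fun j => curry3 (U (iu1 j))) x t +
      vec_at (fun j => curry3 (U (iu2 j))) x t - phi f eps x t in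
    (w^T *m Amat f eps x t *m w) 0 0) = data_density U (x, t).
  rewrite /= data_integrandE// phiE// /data_density /residual /phi_at /sqgrad.
  by rewrite /sqnorm2 /grad_at /curry3 !mxE.
transitivity (\int[@leb1 R]_(t in `]0%R,1%R[) \int[@leb2 R]_(x in @Omega R)
    (data_density U (x, t))%:E)%E.
  by apply: eq_integral => t _; apply: eq_integral => x _; rewrite -dE.
rewrite [RHS]integral_mkcond.
pose K : Z -> \bar R := (fun z => (data_density U z)%:E) \_ (@Dom R).
have mK : measurable_fun setT K.
  have := measurable_restrict_Dom md; move/measurable_EFinP.
  by rewrite -restrict_EFin.
have K0 z : (0 <= K z)%E.
  by rewrite /K patchE; case: ifPn => // _; rewrite lee_fin data_density_ge0.
rewrite -/K [RHS](@fubini_tonelli2 _ _ _ _ _ (@leb2 R) (@leb1 R) K mK K0).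
rewrite integral_mkcond; apply: eq_integral => t _; rewrite patchE /fubini_G.
case: ifPn => [|]; last first.
  rewrite notin_setE => nt; rewrite integral0_eq// => x _.
  by rewrite /K patchE memNset// => -[].
rewrite inE => It; rewrite [LHS](@integral_mkcond _ _ _ (@leb2 R)).
apply: eq_integral => x _.
rewrite /K !patchE; have [Ox|nOx] := pselect (Omega x).
  by rewrite !mem_set.
by rewrite !memNset// => -[].
Qed.

(** All terms are nonnegative and measurable, so they add up in [0, +oo] even for states of infinite
    energy. *)
Lemma energyE U : all_measurable U ->
  energy U = (\int[@leb3 R]_(z in @Dom R) (density U z)%:E)%E.
Proof.
move=> mU; rewrite /energy /Fs data_termE//.
have -> : R1 epsnu lam (fun j i => curry3 (U (iG j i))) =
    (\int[@leb3 R]_(z in @Dom R) (smooth_density U z)%:E)%E.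
  by rewrite /R1 /integ3; apply: eq_integral => -[x t] _.
have -> : R2 (fun j => curry3 (U (iu2 j))) =
    (\int[@leb3 R]_(z in @Dom R) (temporal_density U z)%:E)%E.
  rewrite /R2 /integ3; apply: eq_integral => z; rewrite inE => Dz.
  congr EFin; apply: eq_bigr => j _; congr (_ ^+ 2).
  by rewrite time_integralE ?curry3K.
have md := measurable_data_density mU; have ms := measurable_smooth_density mU.
have mt := measurable_temporal_density mU.
pose fd z := (data_density U z)%:E : \bar R.
pose fs z := (smooth_density U z)%:E : \bar R.
pose ft z := (temporal_density U z)%:E : \bar R.
have mD := @measurable_Dom R.
have mfd : measurable_fun (@Dom R) fd by exact/measurable_EFinP.
have mfs : measurable_fun (@Dom R) fs by exact/measurable_EFinP.
have mft : measurable_fun (@Dom R) ft by exact/measurable_EFinP.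
have mas : measurable_fun (@Dom R) (fun z => (a1%:E * fs z)%E) by exact: measurable_funeM.
have mat : measurable_fun (@Dom R) (fun z => (a2%:E * ft z)%E) by exact: measurable_funeM.
have mds : measurable_fun (@Dom R) (fun z => (fd z + a1%:E * fs z)%E).
  exact: emeasurable_funD.
have d0 z : @Dom R z -> (0 <= fd z)%E by rewrite lee_fin data_density_ge0.
have s0 z : @Dom R z -> (0 <= fs z)%E by rewrite lee_fin smooth_density_ge0.
have t0 z : @Dom R z -> (0 <= ft z)%E by rewrite lee_fin temporal_density_ge0.
have as0 z : @Dom R z -> (0 <= a1%:E * fs z)%E.
  by move=> Dz; rewrite mule_ge0 ?s0// lee_fin ltW.
have at0 z : @Dom R z -> (0 <= a2%:E * ft z)%E.
  by move=> Dz; rewrite mule_ge0 ?t0// lee_fin ltW.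
have ds0 z : @Dom R z -> (0 <= fd z + a1%:E * fs z)%E.
  by move=> Dz; rewrite adde_ge0 ?d0 ?as0.
pose mu : {measure set _ -> \bar R} := @leb3 R.
rewrite -(@ge0_integralZl_EFin _ _ _ mu _ mD _ s0 mfs _ (ltW a10)).
rewrite -(@ge0_integralZl_EFin _ _ _ mu _ mD _ t0 mft _ (ltW a20)).
rewrite -(@ge0_integralD _ _ _ mu _ mD _ _ d0 mfd as0 mas).
by rewrite -(@ge0_integralD _ _ _ mu _ mD _ _ ds0 mds at0 mat).
Qed.

End energy_density.

(** * Integrating pointwise inequalities *)

Section generic_integral_bounds.
Context d (T : measurableType d) (R : realType).
Variables (mu : {measure set T -> \bar R}) (D : set T) (mD : measurable D).
Implicit Types (u v w e : T -> R).

(** The pointwise bound is assumed almost everywhere because time histories are linear in the state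
    only almost everywhere. *)
Lemma integral_midpoint_le w e u v :
  measurable_fun D w -> measurable_fun D e -> measurable_fun D u -> measurable_fun D v ->
  (forall x, 0 <= w x) -> (forall x, 0 <= e x) -> (forall x, 0 <= u x) ->
  (forall x, 0 <= v x) ->
  {ae mu, forall x, D x -> w x + e x <= 2^-1 * u x + 2^-1 * v x} ->
  (\int[mu]_(x in D) (w x)%:E + \int[mu]_(x in D) (e x)%:E <=
   (2^-1)%:E * \int[mu]_(x in D) (u x)%:E + (2^-1)%:E * \int[mu]_(x in D) (v x)%:E)%E.
Proof.
move=> mw me mu_ mv w0 e0 u0 v0 h.
have mE (g : T -> R) : measurable_fun D g -> measurable_fun D (EFin \o g).
  by move=> mg; exact/measurable_EFinP.
have p0 (g : T -> R) : (forall x, 0 <= g x) -> forall x, D x -> (0 <= (g x)%:E)%E.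
  by move=> g0 x _; rewrite lee_fin.
have hu0 (g : T -> R) : (forall x, 0 <= g x) -> forall x, 0 <= 2^-1 * g x.
  by move=> g0 x; rewrite mulr_ge0.
rewrite -(ge0_integralD mu mD (p0 _ w0) (mE _ mw) (p0 _ e0) (mE _ me)).
have i20 : 0 <= 2^-1 :> R by [].
rewrite -(ge0_integralZl_EFin mu mD (p0 _ u0) (mE _ mu_) i20).
rewrite -(ge0_integralZl_EFin mu mD (p0 _ v0) (mE _ mv) i20).
have mh (g : T -> R) : measurable_fun D g -> measurable_fun D (fun x => (2^-1)%:E * (g x)%:E)%E.
  by move=> mg; apply: measurable_funeM; exact: mE.
rewrite -(ge0_integralD mu mD (p0 _ (hu0 _ u0)) (mh _ mu_) (p0 _ (hu0 _ v0)) (mh _ mv)).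
apply: ae_ge0_le_integral => //.
- by move=> x _; rewrite lee_fin addr_ge0.
- by apply/measurable_EFinP; exact: measurable_funD.
- by move=> x _; rewrite lee_fin addr_ge0// hu0.
- by apply: emeasurable_funD; exact: mh.
Qed.

Lemma sqint_scale_le (k : R) u e : 0 <= k -> measurable_fun D u -> measurable_fun D e ->
  (forall x, 0 <= e x) -> (forall x, k * u x ^+ 2 <= e x) ->
  (k%:E * sqint mu D u <= \int[mu]_(x in D) (e x)%:E)%E.
Proof.
move=> k0 mu_ me e0 ue; rewrite /sqint.
have s0 x : D x -> (0 <= (u x ^+ 2)%:E)%E by move=> _; rewrite lee_fin sqr_ge0.
rewrite -(ge0_integralZl_EFin mu mD s0 (measurable_sqr mu_) k0).
apply: ge0_le_integral => //.
- by move=> x _; rewrite -EFinM lee_fin mulr_ge0// sqr_ge0.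
- by apply: measurable_funeM; exact: measurable_sqr.
- exact/measurable_EFinP.
- by move=> x _; rewrite -EFinM lee_fin.
Qed.

End generic_integral_bounds.

(** Meant for the splitting u2 = (u1 + u2) - u1, whose square is at most twice the sum of the
    squares: at a quarter of the rate, the left-hand side becomes the average of two quantities
    bounded by [E]. *)
Lemma quarter_sum_le (R : realType) (k : R) (A B E : \bar R) : 0 <= k ->
  (0 <= A)%E -> (0 <= B)%E -> (k%:E * A <= E)%E -> (k%:E * B <= E)%E ->
  ((k / 4)%:E * (2%:E * A + 2%:E * B) <= E)%E.
Proof.
move=> k0 A0 B0 AE BE.
have E2 : E = ((2^-1)%:E * E + (2^-1)%:E * E)%E.
  rewrite -ge0_muleDl ?lee_fin// -EFinD (_ : 2^-1 + 2^-1 = 1 :> R) ?mul1e//; lra.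
rewrite [leRHS]E2 ge0_muleDr ?mule_ge0// !muleA -!EFinM.
rewrite (_ : k / 4 * 2 = 2^-1 * k); last lra.
by rewrite EFinM -!muleA; apply: leeD; rewrite lee_pmul2l// lte_fin.
Qed.

(** * Midpoint strong convexity of the density *)

Section midpoint.
Variables (R : realType) (f : stfun R) (eps epsnu lam a1 a2 : R).
Hypotheses (eps0 : 0 < eps) (epsnu01 : 0 < epsnu < 1).
Hypotheses (lam0 : 0 < lam) (a10 : 0 < a1) (a20 : 0 < a2).
Local Notation Z := ((R * R) * R)%type.
Implicit Types (U V : comp -> Z -> R) (z : Z).

(* [Sa], [Sb] and [C] stand for |a|^2, |b|^2 and the inner product of a and b. *)
Lemma nu_midpoint (Sa Sb C : R) : 0 <= Sa -> 0 <= Sb ->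
  (forall x y, 0 <= x ^+ 2 * Sa - 2 * (x * y) * C + y ^+ 2 * Sb) ->
  nu epsnu lam ((Sa + Sb + 2 * C) / 4) + epsnu / 4 * (Sa + Sb - 2 * C) <=
  2^-1 * nu epsnu lam Sa + 2^-1 * nu epsnu lam Sb.
Proof.
move=> Sa0 Sb0 psd; have /andP[n0 n1] := epsnu01; rewrite /nu.
have l20 : 0 < lam ^+ 2 by rewrite exprn_gt0.
set P := Num.sqrt (1 + Sa / _); set Q := Num.sqrt (1 + Sb / _).
set W := Num.sqrt (1 + _ / _).
have Pa : 0 < 1 + Sa / lam ^+ 2 by rewrite ltr_pwDl// divr_ge0// ltW.
have Qb : 0 < 1 + Sb / lam ^+ 2 by rewrite ltr_pwDl// divr_ge0// ltW.
have P0 : 0 < P by rewrite sqrtr_gt0.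
have Q0 : 0 < Q by rewrite sqrtr_gt0.
have P2 : P ^+ 2 = 1 + Sa / lam ^+ 2 by rewrite sqr_sqrtr// ltW.
have Q2 : Q ^+ 2 = 1 + Sb / lam ^+ 2 by rewrite sqr_sqrtr// ltW.
(* Cauchy-Schwarz for the vectors (1, a/lam) and (1, b/lam), obtained by testing the positivity
   hypothesis at x = Q, y = P and adding (Q - P)^2 >= 0. *)
have CS : 1 + C / lam ^+ 2 <= P * Q.
  rewrite -(ler_pM2l (mulr_gt0 P0 Q0)).
  have h : 0 <= (Q ^+ 2 * Sa - 2 * (Q * P) * C + P ^+ 2 * Sb) / lam ^+ 2.
    by rewrite divr_ge0// ltW.
  have := sqr_ge0 (Q - P).
  have : (Q ^+ 2 * Sa - 2 * (Q * P) * C + P ^+ 2 * Sb) / lam ^+ 2 =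
    Q ^+ 2 * (P ^+ 2 - 1) - 2 * (P * Q) * (C / lam ^+ 2) + P ^+ 2 * (Q ^+ 2 - 1).
    by rewrite P2 Q2; field; rewrite gt_eqF.
  move: h; set c := C / _ => h hE; rewrite hE in h.
  rewrite sqrrB; nra.
(* Midpoint convexity of sqrt (1 + |a|^2/lam^2), after squaring. The linear part of [nu] then yields
   the term in |a - b|^2 by the parallelogram identity. *)
have WPQ : W <= 2^-1 * P + 2^-1 * Q.
  rewrite -[leRHS]ger0_norm; last by rewrite addr_ge0// mulr_ge0// ltW.
  rewrite -sqrtr_sqr ler_wsqrtr//.
  have -> : (Sa + Sb + 2 * C) / 4 / lam ^+ 2 =
    (P ^+ 2 - 1 + (Q ^+ 2 - 1) + 2 * (C / lam ^+ 2)) / 4.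
    by rewrite P2 Q2; field; rewrite gt_eqF.
  move: CS; set c := C / _ => CS; rewrite sqrrD !exprMn; lra.
have : 0 <= (1 - epsnu) * lam ^+ 2 * (2^-1 * P + 2^-1 * Q - W).
  by apply: mulr_ge0; rewrite ?subr_ge0// mulr_ge0 ?(ltW l20)// subr_ge0 ltW.
move: ((1 - epsnu) * lam ^+ 2) => m; lra.
Qed.

Definition lin (a b : R) U V : comp -> Z -> R := fun i z => a * U i z + b * V i z.
Definition mid U V := lin 2^-1 2^-1 U V.

(** The surplus 1/4 (x - y)^2 of the parallelogram identity, kept only for the coercive parts: sqrt
    eps from [A], epsnu from the linear part of [nu]. *)
Definition gain U V z : R :=
  Num.sqrt eps / 4 * \sum_(j < 2)
    ((V (iu1 j) z + V (iu2 j) z) - (U (iu1 j) z + U (iu2 j) z)) ^+ 2 +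
  a1 * (epsnu / 4) * \sum_(j < 2) \sum_(i < 3) (V (iG j i) z - U (iG j i) z) ^+ 2.

Lemma smooth_density_midpoint U V z :
  smooth_density epsnu lam (mid U V) z +
    epsnu / 4 * \sum_(j < 2) \sum_(i < 3) (V (iG j i) z - U (iG j i) z) ^+ 2 <=
  2^-1 * smooth_density epsnu lam U z + 2^-1 * smooth_density epsnu lam V z.
Proof.
rewrite /smooth_density.
set Sa := \sum_(j < 2) \sum_(i < 3) U (iG j i) z ^+ 2.
set Sb := \sum_(j < 2) \sum_(i < 3) V (iG j i) z ^+ 2.
pose C := \sum_(j < 2) \sum_(i < 3) U (iG j i) z * V (iG j i) z.
have -> : \sum_(j < 2) \sum_(i < 3) mid U V (iG j i) z ^+ 2 = (Sa + Sb + 2 * C) / 4.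
  by rewrite /Sa /Sb /C /mid /lin !big_ord_recl !big_ord0; field.
have -> : \sum_(j < 2) \sum_(i < 3) (V (iG j i) z - U (iG j i) z) ^+ 2 =
    Sa + Sb - 2 * C.
  by rewrite /Sa /Sb /C !big_ord_recl !big_ord0; ring.
apply: nu_midpoint.
- by apply: sumr_ge0 => j _; apply: sumr_ge0 => i _; exact: sqr_ge0.
- by apply: sumr_ge0 => j _; apply: sumr_ge0 => i _; exact: sqr_ge0.
- move=> x y; have -> : x ^+ 2 * Sa - 2 * (x * y) * C + y ^+ 2 * Sb =
    \sum_(j < 2) \sum_(i < 3) (x * U (iG j i) z - y * V (iG j i) z) ^+ 2.
    by rewrite /Sa /Sb /C !big_ord_recl !big_ord0; ring.
  by apply: sumr_ge0 => j _; apply: sumr_ge0 => i _; exact: sqr_ge0.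
Qed.

Lemma data_density_midpoint U V z :
  data_density f eps (mid U V) z + Num.sqrt eps / 4 * \sum_(j < 2)
    ((V (iu1 j) z + V (iu2 j) z) - (U (iu1 j) z + U (iu2 j) z)) ^+ 2 <=
  2^-1 * data_density f eps U z + 2^-1 * data_density f eps V z.
Proof.
have rE j : residual f eps (mid U V) j z =
    2^-1 * residual f eps U j z + 2^-1 * residual f eps V j z.
  by rewrite /residual /mid /lin; field.
have dE j : (V (iu1 j) z + V (iu2 j) z) - (U (iu1 j) z + U (iu2 j) z) =
    residual f eps V j z - residual f eps U j z.
  by rewrite /residual; ring.
rewrite /data_density !rE big_ord_recl big_ord1 !dE.
rewrite (_ : lift _ _ = 1); last exact/val_inj.
have a0 : 0 <= aniso eps (sqgrad f z) by apply: aniso_ge0; exact: sqnorm2_ge0.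
move: (residual _ _ U 0 _) (residual _ _ U 1 _) (residual _ _ V 0 _)
  (residual _ _ V 1 _) => r0 r1 s0 s1.
have := mulr_ge0 a0 (sqr_ge0 (grad_at f 0 z * (r0 - s0) + grad_at f 1 z * (r1 - s1))).
move: (aniso _ _) (grad_at f 0 z) (grad_at f 1 z) (Num.sqrt eps) => a g0 g1 s h.
rewrite -subr_ge0.
set rhs := (X in 0 <= X).
(* The sqrt eps part matches the gain exactly; what is left over is the anisotropic square of the
   difference. *)
suff -> : rhs = 4^-1 * (a * (g0 * (r0 - s0) + g1 * (r1 - s1)) ^+ 2).
  by rewrite mulr_ge0.
by rewrite /rhs; field.
Qed.

Lemma temporal_density_midpoint U V z :
  (forall j, history (mid U V) j z = 2^-1 * history U j z + 2^-1 * history V j z) ->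
  temporal_density (mid U V) z <=
  2^-1 * temporal_density U z + 2^-1 * temporal_density V z.
Proof.
move=> hE; rewrite /temporal_density !mulr_sumr -big_split/=; apply: ler_sum => j _.
rewrite hE -subr_ge0; move: (history U j z) (history V j z) => x y.
have -> : 2^-1 * x ^+ 2 + 2^-1 * y ^+ 2 - (2^-1 * x + 2^-1 * y) ^+ 2 =
  4^-1 * (x - y) ^+ 2 by field.
by rewrite mulr_ge0// sqr_ge0.
Qed.

Lemma density_midpoint U V z :
  (forall j, history (mid U V) j z = 2^-1 * history U j z + 2^-1 * history V j z) ->
  density f eps epsnu lam a1 a2 (mid U V) z + gain U V z <=
  2^-1 * density f eps epsnu lam a1 a2 U z + 2^-1 * density f eps epsnu lam a1 a2 V z.
Proof.
move=> hE; have hd := data_density_midpoint U V z.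
have hs := ler_wpM2l (ltW a10) (smooth_density_midpoint U V z).
have ht := ler_wpM2l (ltW a20) (temporal_density_midpoint hE).
rewrite /density /gain; move: hd hs ht.
move: (data_density _ _ _ _) (data_density _ _ _ _) (data_density _ _ _ _) => d1 d2 d3.
move: (smooth_density _ _ _ _) (smooth_density _ _ _ _) (smooth_density _ _ _ _)
  => s1 s2 s3.
move: (temporal_density _ _) (temporal_density _ _) (temporal_density _ _) => t1 t2 t3.
move: (\sum_(_ < 2) _) (\sum_(_ < 2) _) (Num.sqrt eps) => S1 S2 s; lra.
Qed.

Lemma gain_ge0 U V z : 0 <= gain U V z.
Proof.
have /andP[n0 _] := epsnu01; apply: addr_ge0; apply: mulr_ge0.
- by rewrite divr_ge0 ?sqrtr_ge0.
- by apply: sumr_ge0 => j _; exact: sqr_ge0.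
- by rewrite mulr_ge0 ?divr_ge0 ?ltW.
- by apply: sumr_ge0 => j _; apply: sumr_ge0 => i _; exact: sqr_ge0.
Qed.

Definition gain_rate : R := Num.min (Num.sqrt eps / 4) (a1 * (epsnu / 4)).

Lemma gain_rate_gt0 : 0 < gain_rate.
Proof.
have /andP[n0 _] := epsnu01.
by rewrite /gain_rate lt_min !mulr_gt0 ?sqrtr_gt0.
Qed.

Lemma sum_sqr_ge (I : finType) (F : I -> R) j :
  F j ^+ 2 <= \sum_i F i ^+ 2.
Proof. by rewrite (bigD1 j)//= lerDl sumr_ge0// => i _; exact: sqr_ge0. Qed.

Lemma gain_ge_grad U V j i z :
  gain_rate * (V (iG j i) z - U (iG j i) z) ^+ 2 <= gain U V z.
Proof.
have /andP[n0 _] := epsnu01.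
apply: le_trans (_ : a1 * (epsnu / 4) * (V (iG j i) z - U (iG j i) z) ^+ 2 <= _).
  by rewrite ler_wpM2r ?sqr_ge0// /gain_rate ge_min lexx orbT.
rewrite /gain -[leLHS]add0r; apply: lerD.
  by rewrite mulr_ge0 ?divr_ge0 ?sqrtr_ge0// sumr_ge0// => l _; exact: sqr_ge0.
have c0 : 0 <= a1 * (epsnu / 4) by rewrite mulr_ge0 ?divr_ge0 ?ltW.
rewrite ler_wpM2l//.
apply: le_trans (_ : \sum_(l < 3) (V (iG j l) z - U (iG j l) z) ^+ 2 <= _).
  exact: (sum_sqr_ge (fun l => V (iG j l) z - U (iG j l) z)).
rewrite [leRHS](bigD1 j)//= lerDl sumr_ge0// => l _.
by apply: sumr_ge0 => l' _; exact: sqr_ge0.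
Qed.

Lemma gain_ge_sum U V j z :
  gain_rate * ((V (iu1 j) z + V (iu2 j) z) - (U (iu1 j) z + U (iu2 j) z)) ^+ 2 <=
  gain U V z.
Proof.
have /andP[n0 _] := epsnu01.
rewrite /gain -[leLHS]addr0; apply: lerD; last first.
  have c0 : 0 <= a1 * (epsnu / 4) by rewrite mulr_ge0 ?divr_ge0 ?ltW.
  rewrite mulr_ge0// sumr_ge0// => l _.
  by apply: sumr_ge0 => l' _; exact: sqr_ge0.
apply: ler_pM; rewrite ?sqr_ge0 ?(ltW gain_rate_gt0)//.
  by rewrite /gain_rate ge_min lexx.
exact: (sum_sqr_ge (fun j =>
  (V (iu1 j) z + V (iu2 j) z) - (U (iu1 j) z + U (iu2 j) z))).
Qed.

Lemma measurable_gain U V : all_measurable U -> all_measurable V ->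
  measurable_fun (@Dom R) (gain U V).
Proof.
move=> mU mV; apply: measurable_funD; apply: measurable_funM => //.
- apply: measurable_sum => j; apply: measurable_funX.
  by apply: measurable_funB; exact: measurable_funD.
- apply: measurable_sum => j; apply: measurable_sum => i; apply: measurable_funX.
  exact: measurable_funB.
Qed.

End midpoint.

(** * Existence of the minimizer *)
Section admissible.
Variable R : realType.
Local Notation Z := ((R * R) * R)%type.
Local Notation mu := (@leb3 R).
Local Notation D := (@Dom R).
Local Notation L2Z := (L2D mu D).
Local Notation greenZ := (green mu D).
Implicit Types (U V : comp -> Z -> R) (w : Z -> R).

Lemma continuous_bounded_on (q : Z -> R) : continuous q -> bounded_on D q.
Proof.
move=> cq; split; first exact: continuous_Dom_measurable.
have [K _ KP] := continuous_closedCube_bounded (continuous_subspaceT cq).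
by exists K => z Dz; apply: KP; exact: Dom_subset_closedCube.
Qed.

(** [Xadm] for the flat family: L2 components tied together by linear integral identities, a form
    stable under both combinations and dominated limits. *)
Definition admissible U : Prop :=
  [/\ forall i, L2Z (U i),
    forall j p i, test_fun p ->
      greenZ (uncurry3 (partial p i)) (uncurry3 p) (U (iu1 j)) (U (iG j i)) &
    forall j p, test_fun_top p ->
      greenZ (uncurry3 (partial p ord_max)) (uncurry3 p) (U (iu1 j)) (U (iG j ord_max))].

Lemma L2_curry w : L2Z w <-> L2 (curry3 w).
Proof. by rewrite /L2 curry3K. Qed.

Lemma integ3_curry w (p : stfun R) :
  integ3 (fun x t => curry3 w x t * p x t) =
  (\int[mu]_(z in D) (w z * uncurry3 p z)%:E)%E.
Proof. by apply: eq_integral => -[x t] _. Qed.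

Lemma admissibleP U : admissible U <->
  Xadm (fun j => curry3 (U (iu1 j))) (fun j i => curry3 (U (iG j i)))
       (fun j => curry3 (U (iu2 j))).
Proof.
split=> [[LU gU tU]|[h1 h2]].
- have L i := iffLR (L2_curry (U i)) (LU i).
  split; last by move=> j; exact (L (iu2 j)).
  move=> j; split; last by move=> p pt; rewrite !integ3_curry; exact: tU.
  split; first exact (L (iu1 j)).
  split; first by move=> i; exact (L (iG j i)).
  by move=> p i pt; rewrite !integ3_curry; exact: gU.
- split.
  + move=> [[j|[j i]]|j]; apply/L2_curry; last exact: h2.
      by have [[]] := h1 j.
    by have [[_ [/(_ i)]]] := h1 j.
  + move=> j p i pt; have [[_ [_ wg]] _] := h1 j; move: (wg p i pt).
    by rewrite !integ3_curry.
  + move=> j p pt; have [_ tr] := h1 j; move: (tr p pt).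
    by rewrite !integ3_curry.
Qed.

Lemma C1_fun_bounded_on (p : stfun R) : C1_fun p -> bounded_on D (uncurry3 p).
Proof. by move=> [cp _]; exact: continuous_bounded_on. Qed.

Lemma C1_fun_partial_bounded_on (p : stfun R) i : C1_fun p ->
  bounded_on D (uncurry3 (partial p i)).
Proof. by move=> [_ /(_ i) [_ cp]]; exact: continuous_bounded_on. Qed.

Lemma admissible_measurable U : admissible U -> all_measurable U.
Proof. by move=> [LU _ _] i; have [] := LU i. Qed.

(** Free coefficients serve two purposes: 1/2 and 1/2 give the midpoint, 1 and -1 the difference to
    which the Poincare inequality is applied. *)
Lemma admissible_lin (a b : R) U V :
  admissible U -> admissible V -> admissible (lin a b U V).
Proof.
move=> [LU gU tU] [LV gV tV]; split.
- move=> i; exact: (@L2D_lin _ _ R mu D (@measurable_Dom R) _ _ a b (LU i) (LV i)).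
- move=> j p i pt; have [cp _] := pt.
  exact: (@green_lin _ _ R mu D (@measurable_Dom R) (leb3_Dom_fin R) _ _ _ _ _ _ a b
    (C1_fun_partial_bounded_on i cp) (C1_fun_bounded_on cp)
    (LU _) (LV _) (LU _) (LV _) (gU j p i pt) (gV j p i pt)).
- move=> j p pt; have [cp _] := pt.
  exact: (@green_lin _ _ R mu D (@measurable_Dom R) (leb3_Dom_fin R) _ _ _ _ _ _ a b
    (C1_fun_partial_bounded_on ord_max cp) (C1_fun_bounded_on cp)
    (LU _) (LV _) (LU _) (LV _) (tU j p pt) (tV j p pt)).
Qed.

Lemma admissible0 : admissible (fun _ _ => 0).
Proof.
have g0 q p : greenZ q p (fun=> 0) (fun=> 0).
  rewrite /green.
  have z0 (r : Z -> R) : (\int[mu]_(x in D) (0 * r x)%:E = 0)%E.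
    by rewrite integral0_eq// => z _; rewrite mul0r.
  by rewrite !z0 oppe0.
split=> // i; split; first exact: measurable_cst.
by rewrite /sqint integral0_eq// => z _; rewrite expr0n.
Qed.

Lemma admissible_poincare U j : admissible U ->
  (sqint mu D (U (iu1 j)) <= sqint mu D (U (iG j ord_max)))%E.
Proof.
move=> [LU _ tU]; have [mu1 u1] := LU (iu1 j); have [mg g1] := LU (iG j ord_max).
by apply: poincare => // p pt; exact: tU.
Qed.

(** Over exceptional points [x] the time sections may fail to be integrable, and the integral need
    not be linear there. *)
Lemma history_lin (a b : R) U V : admissible U -> admissible V ->
  {ae mu, forall z j, history (lin a b U V) j z = a * history U j z + b * history V j z}.
Proof.
move=> [LU _ _] [LV _ _].
have ? : Filter (nbhs (almost_everywhere mu)) := ae_filter_ringOfSetsType mu.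
apply: filter_forall => j.
have int w : L2Z w -> mu.-integrable setT (EFin \o (w \_ D)).
  by move=> [mw w2]; apply: integrable_restrict_Dom; exact: L2_integrable.
have h := @volterra_lin _ _ R (@leb2 R) (fun t s => s <= t) _ _ a b
  (@measurable_rel_ge R) (int _ (LU (iu2 j))) (int _ (LV (iu2 j))).
apply: filterS h => z; rewrite /history => <-; congr volterra.
apply/funext => y; rewrite /lin !patchE; case: ifP => // _.
by rewrite !mulr0 addr0.
Qed.

Lemma admissible_closed (U : nat -> comp -> Z -> R) V (M : comp -> Z -> R) :
  (forall n, admissible (U n)) ->
  (forall i, dominated_ae mu D (U ^~ i) (V i) (M i)) -> admissible V.
Proof.
move=> aU dUV.
have mU i n : measurable_fun D (U n i) by exact: admissible_measurable.
split.
- move=> i; exact: (@dominated_ae_L2D _ _ R mu D (@measurable_Dom R) _ _ _ (dUV i)).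
- move=> j p i pt; have [cp _] := pt.
  apply: (@green_cvg _ _ R mu D (@measurable_Dom R) (leb3_Dom_fin R) _ _ _ _ _ _ _ _
    (C1_fun_partial_bounded_on i cp) (C1_fun_bounded_on cp) (mU _) (mU _)
    (dUV _) (dUV _)).
  by move=> n; have [_ gU _] := aU n; exact: gU.
- move=> j p pt; have [cp _] := pt.
  apply: (@green_cvg _ _ R mu D (@measurable_Dom R) (leb3_Dom_fin R) _ _ _ _ _ _ _ _
    (C1_fun_partial_bounded_on ord_max cp) (C1_fun_bounded_on cp) (mU _) (mU _)
    (dUV _) (dUV _)).
  by move=> n; have [_ _ tU] := aU n; exact: tU.
Qed.

Lemma history_cvg (U : nat -> comp -> Z -> R) V (M : comp -> Z -> R) j :
  (forall n, all_measurable (U n)) ->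
  dominated_ae mu D (U ^~ (iu2 j)) (V (iu2 j)) (M (iu2 j)) ->
  {ae mu, forall z, history (U n) j z @[n --> \oo] --> history V j z}.
Proof.
move=> mU [mv iM uv uM _].
have ? : Filter (nbhs (almost_everywhere mu)) := ae_filter_ringOfSetsType mu.
have iM1 := @integrable_onem_add _ _ R mu D (@measurable_Dom R) (leb3_Dom_fin R) _ iM.
apply: (@volterra_cvg _ _ R (@leb2 R) (fun t s => s <= t)
  (fun n => U n (iu2 j) \_ D) _ _ (@measurable_rel_ge R) _ _
  (integrable_restrict_Dom iM1)).
- by move=> n; exact (measurable_restrict_Dom (mU n (iu2 j))).
- exact (measurable_restrict_Dom mv).
- apply: filterS uv => z uvz.
  rewrite (_ : (fun n => (U n (iu2 j) \_ D) z) =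
    (fun n => if z \in D then U n (iu2 j) z else 0)); last first.
    by apply/funext => n; rewrite patchE.
  by rewrite patchE; case: ifPn => [|_]; [rewrite inE; exact: uvz|exact: cvg_cst].
- apply: filterS uM => z uMz n; rewrite !patchE; case: ifPn => [|_].
    rewrite inE => Dz; apply: le_trans (normr_le_sqr1 _) _.
    by rewrite lerD2l uMz.
  by rewrite normr0.
Qed.

End admissible.

(** * Minimising the energy *)

Section minimisation.
Variables (R : realType) (f : stfun R) (eps epsnu lam a1 a2 : R).
Hypotheses (fC1 : C1_closed f) (eps0 : 0 < eps) (epsnu01 : 0 < epsnu < 1).
Hypotheses (lam0 : 0 < lam) (a10 : 0 < a1) (a20 : 0 < a2).
Local Notation Z := ((R * R) * R)%type.
Local Notation mu := (@leb3 R).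
Local Notation D := (@Dom R).
Local Notation E := (energy f eps epsnu lam a1 a2).
Local Notation dens := (density f eps epsnu lam a1 a2).
Local Notation gn := (gain eps epsnu a1).
Implicit Types (U V : comp -> Z -> R).

Lemma energy_ge0 U : admissible U -> (0 <= E U)%E.
Proof.
move=> /admissible_measurable mU; rewrite energyE//.
by apply: integral_ge0 => z _; rewrite lee_fin density_ge0.
Qed.

Lemma energy_midpoint U V : admissible U -> admissible V ->
  (E (mid U V) + \int[mu]_(z in D) (gn U V z)%:E <=
   (2^-1)%:E * E U + (2^-1)%:E * E V)%E.
Proof.
move=> aU aV; have aM : admissible (mid U V) by exact: admissible_lin.
have mU := admissible_measurable aU; have mV := admissible_measurable aV.
have mM := admissible_measurable aM; rewrite !energyE//.
apply: (@integral_midpoint_le _ _ R mu D (@measurable_Dom R)).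
- exact: measurable_density.
- exact: measurable_gain.
- exact: measurable_density.
- exact: measurable_density.
- by move=> z; exact: density_ge0.
- by move=> z; exact: gain_ge0.
- by move=> z; exact: density_ge0.
- by move=> z; exact: density_ge0.
have ? : Filter (nbhs (almost_everywhere mu)) := ae_filter_ringOfSetsType mu.
have := history_lin 2^-1 2^-1 aU aV; apply: filterS => z hz _.
exact: density_midpoint.
Qed.

Lemma gain_ge_sqint U V i : admissible U -> admissible V ->
  ((gain_rate eps epsnu a1 / 4)%:E * sqint mu D (fun z => V i z - U i z)%R <=
   \int[mu]_(z in D) (gn U V z)%:E)%E.
Proof.
move=> aU aV; set k := gain_rate _ _ _.
have k0 : 0 < k by exact: gain_rate_gt0.
have mU := admissible_measurable aU; have mV := admissible_measurable aV.
have mdiff i' : measurable_fun D (fun z => V i' z - U i' z) by exact: measurable_funB.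
have mW j : measurable_fun D (fun z => (V (iu1 j) z + V (iu2 j) z) -
    (U (iu1 j) z + U (iu2 j) z)) by apply: measurable_funB; exact: measurable_funD.
have mg := measurable_gain eps epsnu a1 mU mV.
have g0 z : 0 <= gn U V z by exact: gain_ge0.
have hG j l : (k%:E * sqint mu D (fun z => V (iG j l) z - U (iG j l) z)%R <=
    \int[mu]_(z in D) (gn U V z)%:E)%E.
  apply: (@sqint_scale_le _ _ R mu D (@measurable_Dom R) k _ _ (ltW k0) (mdiff _) mg g0).
  by move=> z; exact: gain_ge_grad.
have hu1 j : (k%:E * sqint mu D (fun z => V (iu1 j) z - U (iu1 j) z)%R <=
    \int[mu]_(z in D) (gn U V z)%:E)%E.
  apply: le_trans (hG j ord_max); rewrite lee_pmul2l ?lte_fin//.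
  have := admissible_poincare j (admissible_lin 1 (-1) aV aU).
  have lE i' : lin 1 (-1) V U i' = (fun z => V i' z - U i' z).
    by apply/funext => z; rewrite /lin mul1r mulN1r.
  by rewrite !lE.
have hW j : (k%:E * sqint mu D (fun z => (V (iu1 j) z + V (iu2 j) z) -
    (U (iu1 j) z + U (iu2 j) z))%R <= \int[mu]_(z in D) (gn U V z)%:E)%E.
  apply: (@sqint_scale_le _ _ R mu D (@measurable_Dom R) k _ _ (ltW k0) (mW j) mg g0).
  by move=> z; exact: gain_ge_sum.
(* Only [u2] pays the factor 4; the other components are weakened to the same rate, since the
   abstract minimisation takes one constant for all of them. *)
have weaken (s : \bar R) : (0 <= s)%E -> ((k / 4)%:E * s <= k%:E * s)%E.
  by move=> s0; rewrite lee_wpmul2r// lee_fin; lra.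
case: i => [[j|[j l]]|j].
- apply: le_trans (hu1 j); apply: weaken; exact: sqint_ge0.
- apply: le_trans (hG j l); apply: weaken; exact: sqint_ge0.
- apply: le_trans (quarter_sum_le (ltW k0) _ _ (hW j) (hu1 j)); last 2 first.
  + exact: sqint_ge0.
  + exact: sqint_ge0.
  rewrite lee_wpmul2l ?lee_fin ?divr_ge0 ?(ltW k0)//.
  have := @sqint_lin _ _ R mu D (@measurable_Dom R) _ _ 1 (-1) (mW j) (mdiff (iu1 j)).
  rewrite sqrrN expr1n mulr1.
  congr (sqint _ _ _ <= _)%E; apply/funext => z /=; ring.
Qed.

Lemma density_cvg (U : nat -> comp -> Z -> R) V z :
  (forall i, U ^~ i ^~ z @ \oo --> V i z) ->
  (forall j, history (U n) j z @[n --> \oo] --> history V j z) ->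
  dens (U n) z @[n --> \oo] --> dens V z.
Proof.
move=> cU ch.
have cr j : residual f eps (U n) j z @[n --> \oo] --> residual f eps V j z.
  by apply: cvgB; [exact: cvgD|exact: cvg_cst].
have csqr (x : R^nat) (l : R) : x @ \oo --> l -> x n ^+ 2 @[n --> \oo] --> l ^+ 2.
  by move=> xl; rewrite expr2; under eq_fun do rewrite expr2; exact: cvgM.
have csum n (x : nat -> 'I_n -> R) (l : 'I_n -> R) :
    (forall i, x ^~ i @ \oo --> l i) ->
    \sum_(i < n) x m i @[m --> \oo] --> \sum_(i < n) l i.
  elim: n x l => [|n IHn] x l xl.
    by rewrite big_ord0; under eq_fun do rewrite big_ord0; exact: cvg_cst.
  rewrite big_ord_recl; under eq_fun do rewrite big_ord_recl.
  by apply: cvgD => //; apply: (IHn (fun m i => x m (lift ord0 i))) => i; exact: xl.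
apply: cvgD; last first.
  by apply: cvgM; [exact: cvg_cst|apply: csum => j; exact: csqr].
apply: cvgD.
- apply: cvgD; apply: cvgM; try exact: cvg_cst.
    by apply: csqr; apply: cvgD; apply: cvgM; try exact: cvg_cst; exact: cr.
  by apply: cvgD; apply: csqr.
- apply: cvgM; first exact: cvg_cst.
  have cS : (\sum_(j < 2) \sum_(i < 3) U n (iG j i) z ^+ 2) @[n --> \oo] -->
      \sum_(j < 2) \sum_(i < 3) V (iG j i) z ^+ 2.
    by apply: (csum 2%N) => j; apply: (csum 3%N) => i; exact: csqr.
  apply: cvgD; first by apply: cvgM; [exact: cvg_cst|].
  apply: cvgM; first exact: cvg_cst.
  apply: cvgB; last exact: cvg_cst.
  apply: (continuous_cvg _ (@sqrt_continuous R _)).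
  by apply: cvgD; [exact: cvg_cst|apply: cvgM => //; exact: cvg_cst].
Qed.

Lemma energy_lsc (U : nat -> comp -> Z -> R) V (M : comp -> Z -> R)
    (b : (\bar R)^nat) l : (forall n, admissible (U n)) ->
  (forall i, dominated_ae mu D (U ^~ i) (V i) (M i)) ->
  (forall n, E (U n) <= b n)%E -> b @ \oo --> l -> (E V <= l)%E.
Proof.
move=> aU dUV Ub bl; have aV := admissible_closed aU dUV.
have mU n := admissible_measurable (aU n); have mV := admissible_measurable aV.
rewrite energyE//.
apply: (@fatou_ae_le _ _ R mu D (@measurable_Dom R) (fun n => dens (U n)) (dens V) b l
  _ _ _ _ _ _ bl).
- by move=> n; exact: measurable_density.
- exact: measurable_density.
- by move=> n z _; exact: density_ge0.
- by move=> z _; exact: density_ge0.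
- have ? : Filter (nbhs (almost_everywhere mu)) := ae_filter_ringOfSetsType mu.
  have h1 : {ae mu, forall z i, D z -> U ^~ i ^~ z @ \oo --> V i z}.
    by apply: filter_forall => i; have [] := dUV i.
  have h2 : {ae mu, forall z j, history (U n) j z @[n --> \oo] --> history V j z}.
    by apply: filter_forall => j; exact: history_cvg.
  move: h1 h2; apply: filterS2 => z h1 h2 Dz; apply: density_cvg => // i.
  exact: h1.
- by move=> n; rewrite -energyE.
Qed.

Lemma energy_minimizer :
  exists2 U, admissible U & forall V, admissible V -> (E U <= E V)%E.
Proof.
apply: (@strongly_convex_minimizer _ _ R mu D (@measurable_Dom R) comp (@admissible R)
  (energy f eps epsnu lam a1 a2) (gain_rate eps epsnu a1 / 4) (fun _ _ => 0)).
- by rewrite divr_gt0 ?gain_rate_gt0.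
- exact: admissible0.
- exact: energy_ge0.
- by move=> U i [].
- move=> U V aU aV; exists (mid U V); first exact: admissible_lin.
  move=> i; apply: le_trans (energy_midpoint aU aV); apply: leeD => //.
  exact: gain_ge_sqint.
- move=> U V M aU dUV; split; first exact: admissible_closed aU dUV.
  by move=> b l; exact: energy_lsc aU dUV.
Qed.

End minimisation.

Theorem mainTheorem1 (R : realType) (f : stfun R) (eps epsnu lam a1 a2 : R) :
  C1_closed f -> 0 < eps -> 0 < epsnu < 1 -> 0 < lam -> 0 < a1 -> 0 < a2 ->
  exists (u1 : vfield R) (G1 : 'I_2 -> 'I_3 -> stfun R) (u2 : vfield R),
    Xadm u1 G1 u2 /\
    forall (v1 : vfield R) (H1 : 'I_2 -> 'I_3 -> stfun R) (v2 : vfield R),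
      Xadm v1 H1 v2 ->
      (Fs f eps epsnu lam a1 a2 u1 G1 u2 <= Fs f eps epsnu lam a1 a2 v1 H1 v2)%E.
Proof.
move=> fC1 e0 n01 l0 a10 a20.
have [U aU Umin] := energy_minimizer fC1 e0 n01 l0 a10 a20.
exists (fun j => curry3 (U (iu1 j))), (fun j i => curry3 (U (iG j i))),
  (fun j => curry3 (U (iu2 j))); split; first exact/admissibleP.
move=> v1 H1 v2 av.
(* A competitor is regrouped into one flat family; currying it back is convertible to the original,
   so both admissibility and energy transfer directly. *)
pose V (i : comp) : (R * R) * R -> R := match i with
  | inl (inl j) => uncurry3 (v1 j)
  | inl (inr (j, l)) => uncurry3 (H1 j l)
  | inr j => uncurry3 (v2 j) end.
have aV : admissible V by apply/admissibleP.
exact: Umin aV.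
Qed.
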